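(* Let $(f_n)$ be a regular polynomial sequence with $\deg f_n=d_n$, let $l>0$ be an integer, and write $$\frac{F_l(z)}{p_l}=z^{D}+a_{D-1}z^{D-1}+\cdots+a_1z+a_0,\qquad D=d_1d_2\cdots d_l,$$ where $p_l$ is the leading coefficient of $F_l$. Then for each $k\in\{1,2,\ldots,D-1\}$ the moment $c_k=\int x^k\,d\mu_{J_{(f_n)}}(x)$ satisfies $$c_k=\frac{s_k(F_l(z))}{d_1\cdots d_l},$$ where $s_k(F_l(z))$ is the sum of the $k$-th powers of the roots of $F_l$ (counted with multiplicity), which can be calculated recursively by Newton's identities: for $k=1,\ldots,D-1$, $$s_k(F_l(z))+a_{D-1}\,s_{k-1}(F_l(z))+\cdots+a_{D-k+1}\,s_1(F_l(z))=-k\,a_{D-k}.$$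
   Context: A sequence of complex polynomials $f_n(z)=\sum_{j=0}^{d_n}a_{n,j}z^j$ with $d_n\ge2$, $a_{n,d_n}\ne0$ for all $n\in\mathbb{N}$ is called a regular polynomial sequence, written $(f_n)\in\mathcal{R}$, if there are positive real numbers $A_1,A_2,A_3$ such that for all $n\in\mathbb{N}$: $|a_{n,d_n}|\ge A_1$; $|a_{n,j}|\le A_2|a_{n,d_n}|$ for $j=0,1,\ldots,d_n-1$; and $\log|a_{n,d_n}|\le A_3 d_n$. Put $F_0(z)=z$ and $F_n=f_n\circ F_{n-1}$, so $F_n=f_n\circ\cdots\circ f_1$ has degree $d_1\cdots d_n$. (The coefficients $a_i$ with a single index in the claim are those of the monic polynomial $F_l/p_l$.) The Fatou set of $(f_n)$ is the set of points of $\overline{\mathbb{C}}$ at which (i.e. on some neighbourhood of which) the sequence $(F_n)_{n\ge1}$ is normal in the sense of Montel, and the Julia set $J_{(f_n)}$ is its complement in $\overline{\mathbb{C}}$. For $(f_n)\in\mathcal{R}$, $J_{(f_n)}$ is a compact non-polar subset of $\mathbb{C}$; $\mu_{J_{(f_n)}}$ denotes its equilibrium measure. For a polynomial $f$ of degree $n$ with roots $z_1,\ldots,z_n$ counted with multiplicity, $s_k(f(z)):=\sum_{j=1}^n z_j^k$. *)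

(* Defs.v *)
From HB Require Import structures.
From mathcomp Require Import all_boot all_order all_algebra.
From mathcomp Require Import all_classical all_reals all_analysis.
From mathcomp Require Import complex.
Export numFieldNormedType.Exports.

Set Implicit Arguments.
Unset Strict Implicit.
Unset Printing Implicit Defensive.

Import Order.TTheory GRing.Theory Num.Theory.

Local Open Scope classical_set_scope.
Local Open Scope ring_scope.
Local Open Scope complex_scope.

(* The complex plane is R[i]. Its topology is carried by the alias R[i]^o,
   whose elements are those of R[i]. *)

(* |z| as an element of R; the norm `|z| of R[i] takes its values in R[i]. *)
Definition cmod (R : realType) (z : R[i]) : R := ComplexField.Normc.normc z.

Definition deg (K : nzSemiRingType) (p : {poly K}) : nat := (size p).-1.

(* Sequences f_1, f_2, ... are functions on nat whose value at 0 is ignored. *)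

(* As 2 <= deg (f n) excludes f n = 0, lead_coef (f n) is the coefficient
   a_{n,d_n}, and it is nonzero. *)
Definition regular_polynomial_sequence (R : realType)
    (f : nat -> {poly R[i]}) : Prop :=
  (forall n, (0 < n)%N -> (2 <= deg (f n))%N) /\
  exists A1 A2 A3 : R, [/\ 0 < A1, 0 < A2, 0 < A3 &
    forall n, (0 < n)%N ->
      [/\ A1 <= cmod (lead_coef (f n)),
          forall j, (j < deg (f n))%N ->
            cmod (f n)`_j <= A2 * cmod (lead_coef (f n)) &
          ln (cmod (lead_coef (f n))) <= A3 * (deg (f n))%:R]].

Fixpoint composition (R : realType) (f : nat -> {poly R[i]}) (n : nat)
    : {poly R[i]} :=
  if n is m.+1 then f n \Po composition f m else 'X.

Notation riemann_sphere R := (one_point_compactification R[i]^o).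

(* A nonconstant polynomial, extended by the value oo at oo. *)
Definition sphere_map (R : realType) (p : {poly R[i]})
    (x : riemann_sphere R) : riemann_sphere R :=
  if x is Some z then Some p.[z] else None.

Definition chordal (R : realType) (x y : riemann_sphere R) : R :=
  match x, y with
  | Some z, Some w =>
      2 * cmod ((z : R[i]) - (w : R[i])) /
      (Num.sqrt (1 + cmod z ^+ 2) * Num.sqrt (1 + cmod w ^+ 2))
  | Some z, None | None, Some z => 2 / Num.sqrt (1 + cmod z ^+ 2)
  | None, None => 0
  end.

Definition locally_uniform_cvg (R : realType) (U : set (riemann_sphere R))
    (g : nat -> riemann_sphere R -> riemann_sphere R)
    (h : riemann_sphere R -> riemann_sphere R) : Prop :=
  forall K : set (riemann_sphere R), compact K -> K `<=` U ->
  forall e : R, 0 < e ->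
    \forall n \near \oo, forall x, K x -> chordal (g n x) (h x) < e.

Definition normal_on (R : realType) (U : set (riemann_sphere R))
    (g : nat -> riemann_sphere R -> riemann_sphere R) : Prop :=
  forall phi : nat -> nat, {homo phi : m n / (m < n)%N} ->
  exists psi : nat -> nat, {homo psi : m n / (m < n)%N} /\
  exists h, locally_uniform_cvg U (fun n => g (phi (psi n))) h.

(* The sequence starts at F_1, hence the shift of the index. *)
Definition fatou_set (R : realType) (f : nat -> {poly R[i]})
    : set (riemann_sphere R) :=
  [set x | exists U : set (riemann_sphere R), [/\ open U, U x &
    normal_on U (fun n => sphere_map (composition f n.+1))]].

Definition julia_set (R : realType) (f : nat -> {poly R[i]})
    : set (riemann_sphere R) := ~` fatou_set f.

(* C with its Borel sigma-algebra. *)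
Definition borelC (R : realType) := g_sigma_algebraType (@open R[i]^o).

(* The logarithmic energy, i.e. the double integral of log (1 / |z - w|).
   As lne 0 = -oo, the integrand is +oo on the diagonal. *)
Definition energy (R : realType) (mu : probability (borelC R) R) : \bar R :=
  (\int[mu]_z \int[mu]_w (- lne (cmod ((z : R[i]) - (w : R[i])))%:E))%E.

(* mu is the equilibrium measure of K: a Borel probability measure on K of
   least logarithmic energy, this least energy being finite (K is non-polar).
   A non-polar compact set has exactly one. *)
Definition is_equilibrium_measure (R : realType) (K : set R[i])
    (mu : probability (borelC R) R) : Prop :=
  [/\ mu K = 1%E, (energy mu < +oo)%E &
      forall nu : probability (borelC R) R,
        nu K = 1%E -> (energy mu <= energy nu)%E].

(* The part of the Julia set in C, which is all of it for regular sequences. *)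
Definition julia_in_plane (R : realType) (f : nat -> {poly R[i]})
    : set R[i] := [set z | julia_set f (Some z)].

Definition moment (R : realType) (mu : probability (borelC R) R) (k : nat)
    : R[i] :=
  (\int[mu]_z complex.Re ((z : R[i]) ^+ k)) +i* (\int[mu]_z complex.Im ((z : R[i]) ^+ k)).

(* The roots of p, repeated according to multiplicity. *)
Definition roots (R : realType) (p : {poly R[i]}) : seq R[i] :=
  sval (closed_field_poly_normal p).

Definition power_sum (R : realType) (k : nat) (p : {poly R[i]}) : R[i] :=
  \sum_(z <- roots p) z ^+ k.

(* Main.v *)
(* Let F = F_l and D = deg F, and let sigma be the average of mu over the fibres of
   F: the sigma-integral of phi is the mu-integral of
   z |-> (1/D) sum_(F(x) = F(z)) phi(x). As F^-1(F(J)) = J, sigma lives on J. As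
   sum_(F(x) = F(w)) log |z - x| depends on z only through F(z), the mutual energies
   satisfy I(mu, sigma) = I(sigma, sigma). When they are finite,
   I(mu) - I(sigma) = I(mu - sigma), which is nonnegative since the logarithmic
   kernel is positive definite; the minimality of I(mu) forces I(mu - sigma) = 0,
   hence mu and sigma have the same moments. The k-th moment of sigma is the
   mu-mean of s_k(F - F(z)) / D, and for k < D Newton's identities show that
   s_k(F - w) does not depend on w.

   Positive definiteness is elementary. Once J is scaled into the disc of radius
   1/2, - log |a - b|^2 is the increasing limit, as e tends to 0, of
   - log |1 - a b^*|^2 - log (1 - (1 - e) r), where
   r = (1 - |a|^2) (1 - |b|^2) / |1 - a b^*|^2, and both terms are power series with
   nonnegative coefficients in positive definite kernels; the first one contains
   2 Re c^k / k with c = a b^*, which controls the k-th moment. The energies I(sigma) and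
   I(mu, sigma) are finite because the regularized ones satisfy
   I_e(sigma) <= D I_e(mu, sigma) + const, which bounds I_e(mu, sigma) through
   I_e(mu - sigma / D) >= 0. *)
Require Import Defs.
From HB Require Import structures.
From mathcomp Require Import all_boot all_order all_algebra.
From mathcomp Require Import all_classical all_reals all_analysis.
From mathcomp Require Import measurable_realfun giry.
From mathcomp Require Import complex ring lra zify.

Set Implicit Arguments.
Unset Strict Implicit.
Unset Printing Implicit Defensive.

Import Order.TTheory GRing.Theory Num.Theory.

Local Open Scope classical_set_scope.
Local Open Scope ring_scope.
Local Open Scope complex_scope.

(* [fingraph] exports another [roots]. *)
Local Notation roots := (@Defs.roots _).

(** The energies may be infinite, so I(mu) - 2 I(mu, sigma) + I(sigma) cannot be formed directly.
    Scaling and a constant shift make all kernels nonnegative, so that Tonelli's theorem and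
    monotone convergence apply without any finiteness; subtraction takes place only between
    regularized energies, which are real numbers since the regularized kernels are bounded. The
    identity I(mu, sigma) = I(sigma, sigma) rests on a product formula over fibres that
    regularization destroys: at that level only an inequality with a factor D survives, and the
    exact identity is used for the limit kernels. The signed measure mu - t sigma never occurs; its
    quadratic form is written out, with t = 1/D for finiteness and t = 1 for the conclusion. That
    sigma is a measure at all requires the fibre averages to depend measurably on the point, which
    comes from the lower semicontinuity of the number of roots in an open set. *)

Section Newton.
Variable K : fieldType.
Implicit Types (s : seq K) (z : K).

Lemma deriv_prod_XsubC s :
  (\prod_(z <- s) ('X - z%:P))^`() =
  \sum_(z <- s) (\prod_(x <- s) ('X - x%:P)) %/ ('X - z%:P).
Proof.
elim: s => [|a s IH]; first by rewrite !big_nil derivC.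
rewrite !big_cons derivM derivXsubC mul1r IH mulKp ?polyXsubC_eq0 //.
congr (_ + _); rewrite mulr_sumr big_seq [RHS]big_seq; apply: eq_bigr => z zs.
by apply: divp_mulA; rewrite dvdp_XsubCl root_prod_XsubC.
Qed.

(** Synthetic division: read from the top, the coefficients of the quotient are the partial sums of
    Horner's scheme. *)
Lemma coef_divp_XsubC (p : {poly K}) z n i : root p z -> size p = n.+1 -> (i < n)%N ->
  (p %/ ('X - z%:P))`_(n.-1 - i) = \sum_(r < i.+1) p`_(n - r) * z ^+ (i - r).
Proof.
move=> rpz sp; set q := p %/ _.
have pq : p = q * ('X - z%:P) by apply/esym/divpK; rewrite dvdp_XsubCl.
have coefq j : p`_j.+1 = q`_j - z * q`_j.+1.
  by rewrite pq mulrBr coefB coefMX /= coefMC mulrC.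
have qn : q`_n = 0.
  rewrite nth_default // /q size_divp ?polyXsubC_eq0 // size_XsubC sp; lia.
elim: i => [|i IH] lt_in.
  rewrite big_ord1 subn0 expr0 mulr1 subn0.
  have := coefq n.-1; rewrite prednK // qn mulr0 subr0 => -> //.
rewrite big_ord_recr /= subnn expr0 mulr1.
have -> : (n - i.+1 = (n.-1 - i.+1).+1)%N by lia.
have := coefq (n.-1 - i.+1)%N.
have -> : ((n.-1 - i.+1).+1 = n.-1 - i)%N by lia.
rewrite [X in _ - z * X]IH; last by lia.
move=> ->; rewrite mulr_sumr addrC -addrA -[LHS]addr0; congr (_ + _).
apply/eqP; rewrite eq_sym addrC subr_eq0; apply/eqP; apply: eq_bigr => r _.
by rewrite mulrCA -exprS -subSn // -ltnS.
Qed.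

(** The coefficient of index [n - 1 - k] of the derivative of [p] is computed twice: directly, and
    as a sum over the roots of the coefficients of [p / (X - z)]. *)
Lemma newton_identity s k : (0 < k < size s)%N ->
  let p := \prod_(z <- s) ('X - z%:P) in
  let ps := fun j => \sum_(z <- s) z ^+ j in
  ps k + \sum_(1 <= j < k) p`_(size s - j)%N * ps (k - j)%N
    = - (k%:R * p`_(size s - k)%N).
Proof.
move=> /andP[k0 ks] p ps; set n := size s.
have sp : size p = n.+1 by rewrite size_prod_XsubC.
have pn : p`_n = 1.
  by have /monicP := monic_prod_XsubC s predT id; rewrite lead_coefE sp.
have := congr1 (fun q : {poly K} => q`_(n.-1 - k)) (deriv_prod_XsubC s).
rewrite -/p coef_deriv coef_sum.
have -> : ((n.-1 - k).+1 = n - k)%N by lia.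
rewrite big_seq (eq_bigr (fun z => \sum_(r < k.+1) p`_(n - r) * z ^+ (k - r))); last first.
  move=> z zs; apply: coef_divp_XsubC; rewrite ?root_prod_XsubC //.
rewrite -big_seq exchange_big /=.
rewrite (eq_bigr (fun r : 'I_k.+1 => p`_(n - r) * ps (k - r)%N)); last first.
  by move=> r _; rewrite mulr_sumr.
rewrite big_ord_recr /= subnn -(big_mkord xpredT (fun r => p`_(n - r) * ps (k - r)%N)).
rewrite big_ltn // subn0 subn0 pn mul1r => H.
have -> : ps k + \sum_(1 <= j < k) p`_(n - j) * ps (k - j)%N =
    p`_(n - k) *+ (n - k) - p`_(n - k) * ps 0%N by rewrite H addrK.
(* The zeroth power sum is the number n of roots, so (n - k) - n leaves the factor - k. *)
rewrite /ps (eq_bigr (fun=> 1)); last by move=> z _; rewrite expr0.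
rewrite big_const_seq count_predT iter_addr_0 -/n mulrnBr ?(ltnW ks) //.
by rewrite mulr_natr addrAC subrr add0r mulr_natl.
Qed.

(** For k < n, Newton's identities only involve coefficients of index at least n - k > 0, so the
    constant coefficients never enter. *)
Lemma eq_power_sums s t n : size s = n -> size t = n ->
  (forall j, (0 < j)%N ->
    (\prod_(z <- s) ('X - z%:P))`_j = (\prod_(z <- t) ('X - z%:P))`_j) ->
  forall k, (0 < k < n)%N -> \sum_(z <- s) z ^+ k = \sum_(z <- t) z ^+ k.
Proof.
move=> ss st eqst k; elim/ltn_ind: k => k IH /andP[k0 kn].
have := @newton_identity s k; have := @newton_identity t k.
rewrite ss st k0 kn => /(_ isT) /= Ht /(_ isT) /= Hs.
apply: (@addIr _ (\sum_(1 <= j < k) (\prod_(z <- t) ('X - z%:P))`_(n - j) *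
                  \sum_(z <- t) z ^+ (k - j))).
rewrite Ht -eqst; last by lia.
rewrite -Hs; congr (_ + _); apply: eq_big_nat => j /andP[j0 jk].
rewrite -eqst; last by lia.
by congr (_ * _); rewrite IH //; lia.
Qed.

End Newton.

(** * Degrees of compositions, roots and fibres of polynomials *)

Section Composition.
Variable R : realType.
Implicit Types (f : nat -> {poly R[i]}) (p : {poly R[i]}).

Lemma horner_composition f n z :
  (composition f n.+1).[z] = (f n.+1).[(composition f n).[z]].
Proof. by rewrite /= horner_comp. Qed.

Lemma deg_composition f n : (forall i, (0 < i)%N -> (2 <= deg (f i))%N) ->
  size (composition f n) = (\prod_(1 <= i < n.+1) deg (f i)).+1.
Proof.
move=> df.
have: (size (composition f n)).-1 = (\prod_(1 <= i < n.+1) deg (f i))%N.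
  elim: n => [|n IH]; first by rewrite /= size_polyX big_geq.
  by rewrite /= size_comp_poly IH [in RHS]big_nat_recr //= mulnC.
(* Positivity of the degree excludes size 0, which [.-1] does not distinguish from size 1. *)
have: (0 < \prod_(1 <= i < n.+1) deg (f i))%N.
  by rewrite big_nat; apply: prodn_cond_gt0 => i /andP[i0 _]; apply/ltnW/df.
by case: (size _) => [|m] /=; move=> + eD; rewrite -eD.
Qed.

Lemma rootsE p : p = lead_coef p *: \prod_(z <- roots p) ('X - z%:P).
Proof. exact: (svalP (closed_field_poly_normal p)). Qed.

Lemma size_roots p : p != 0 -> size (roots p) = (size p).-1.
Proof.
move=> p0; have := congr1 (fun q : {poly R[i]} => size q) (rootsE p).
by rewrite size_scale ?lead_coef_eq0 // size_prod_XsubC => ->.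
Qed.

Lemma mem_roots p z : p != 0 -> (z \in roots p) = (p.[z] == 0).
Proof.
move=> p0; rewrite -[_ == 0]/(root p z) [in RHS](rootsE p) rootZ ?lead_coef_eq0 //.
by rewrite root_prod_XsubC.
Qed.

Lemma horner_roots p z : p.[z] = lead_coef p * \prod_(x <- roots p) (z - x).
Proof.
rewrite {1}(rootsE p) hornerZ horner_prod; congr (_ * _).
by apply: eq_bigr => x _; rewrite hornerXsubC.
Qed.

End Composition.

Section Fibre.
Variables (R : realType) (F : {poly R[i]}).
Hypothesis F_gt1 : (1 < size F)%N.

Definition fibre (w : R[i]) := roots (F - w%:P).

Lemma size_subC w : size (F - w%:P) = size F.
Proof.
by rewrite size_polyDl // size_polyN size_polyC (leq_ltn_trans _ F_gt1) // leq_b1.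
Qed.

Lemma lead_coef_subC w : lead_coef (F - w%:P) = lead_coef F.
Proof.
by rewrite lead_coefDl // size_polyN size_polyC (leq_ltn_trans _ F_gt1) // leq_b1.
Qed.

Lemma subC_neq0 w : F - w%:P != 0.
Proof. by rewrite -size_poly_gt0 size_subC ltnW. Qed.

Lemma size_fibre w : size (fibre w) = (size F).-1.
Proof. by rewrite size_roots ?subC_neq0 // size_subC. Qed.

Lemma mem_fibre w z : (z \in fibre w) = (F.[z] == w).
Proof. by rewrite mem_roots ?subC_neq0 // hornerD hornerN hornerC subr_eq0. Qed.

Lemma horner_fibre w z :
  F.[z] - w = lead_coef F * \prod_(x <- fibre w) (z - x).
Proof.
have := horner_roots (F - w%:P) z.
by rewrite lead_coef_subC hornerD hornerN hornerC.
Qed.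

Lemma power_sum_fibre w k : (0 < k < (size F).-1)%N ->
  \sum_(z <- fibre w) z ^+ k = power_sum k F.
Proof.
move=> kF; apply: (@eq_power_sums _ _ _ (size F).-1) => //.
- exact: size_fibre.
- by rewrite size_roots // -size_poly_gt0 ltnW.
- move=> j j0; apply: (@mulfI _ (lead_coef F)).
    by rewrite lead_coef_eq0 -size_poly_gt0 ltnW.
  rewrite -coefZ -{1}(lead_coef_subC w) -rootsE -coefZ -rootsE.
  by rewrite coefB coefC (gtn_eqF j0) subr0.
Qed.

End Fibre.

Lemma normalized_newton (R : realType) (F : {poly R[i]}) D k :
  size F = D.+1 -> (0 < k < D)%N ->
  let a := fun j => ((lead_coef F)^-1 *: F)`_j in
  power_sum k F + \sum_(1 <= j < k) a (D - j)%N * power_sum (k - j) F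
      = - (k%:R * a (D - k)%N).
Proof.
move=> sF kD a; have F0 : F != 0 by rewrite -size_poly_gt0 sF.
have sr : size (roots F) = D by rewrite size_roots // sF.
have := @newton_identity _ (roots F) k; rewrite sr => /(_ kD) /=.
suff -> : \prod_(z <- roots F) ('X - z%:P) = (lead_coef F)^-1 *: F by [].
by rewrite {3}(rootsE F) scalerA mulVf ?lead_coef_eq0 // scale1r.
Qed.

Lemma normalized_expansion (R : realType) (F : {poly R[i]}) D :
  size F = D.+1 ->
  (lead_coef F)^-1 *: F =
    'X^D + \sum_(j < D) ((lead_coef F)^-1 *: F)`_j *: 'X^j.
Proof.
move=> sF; have F0 : lead_coef F != 0 by rewrite lead_coef_eq0 -size_poly_gt0 sF.
rewrite -{1}[_ *: F]coefK poly_def size_scale ?invr_eq0 // sF big_ord_recr /= addrC.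
congr (_ + _); rewrite coefZ.
by rewrite lead_coefE sF /= mulVf ?scale1r //; move: F0; rewrite lead_coefE sF.
Qed.

(** * The logarithmic series *)

Section Modulus.
Variable R : realType.
Implicit Types z w : R[i].

Lemma cmod_normr z : `|z| = (cmod z)%:C.
Proof. by []. Qed.

Lemma cmod_ge0 z : 0 <= cmod z.
Proof. by case: z => a b; exact: sqrtr_ge0. Qed.

Lemma cmodM z w : cmod (z * w) = cmod z * cmod w.
Proof. exact: ComplexField.Normc.normcM. Qed.

Lemma cmod0 : cmod (0 : R[i]) = 0.
Proof. exact: ComplexField.Normc.normc0. Qed.

Lemma cmod1 : cmod (1 : R[i]) = 1.
Proof. exact: ComplexField.Normc.normc1. Qed.

Lemma cmodX z n : cmod (z ^+ n) = cmod z ^+ n.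
Proof. by elim: n => [|n IH]; rewrite ?expr0 ?cmod1 // !exprS cmodM IH. Qed.

Lemma cmodN z : cmod (- z) = cmod z.
Proof. exact: normcN. Qed.

Lemma cmodV z : cmod z^-1 = (cmod z)^-1.
Proof. exact: ComplexField.Normc.normcV. Qed.

Lemma cmodD z w : cmod (z + w) <= cmod z + cmod w.
Proof. exact: le_normcD. Qed.

Lemma cmodB z w : cmod z - cmod w <= cmod (z - w).
Proof. by rewrite lerBlDr -{1}(subrK w z) cmodD. Qed.

Lemma cmod_distC z w : cmod (z - w) = cmod (w - z).
Proof. by rewrite -cmodN opprB. Qed.

Lemma cmod_eq0 z : (cmod z == 0) = (z == 0).
Proof.
apply/eqP/eqP => [/(@ComplexField.Normc.eq0_normc R) // | ->].
exact: cmod0.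
Qed.

Lemma cmod_gt0 z : (0 < cmod z) = (z != 0).
Proof. by rewrite lt_def cmod_ge0 andbT cmod_eq0. Qed.

Lemma cmod_real (x : R) : cmod x%:C = `|x|.
Proof. by rewrite /cmod /= expr0n addr0 sqrtr_sqr. Qed.

Lemma sqr_cmod z : cmod z ^+ 2 = complex.Re z ^+ 2 + complex.Im z ^+ 2.
Proof. by case: z => a b; rewrite sqr_sqrtr ?addr_ge0 ?sqr_ge0. Qed.

Lemma cmodJ z : cmod z^* = cmod z.
Proof. by case: z => a b; rewrite /cmod /= sqrrN. Qed.

Lemma Re_le_cmod z : `|complex.Re z| <= cmod z.
Proof.
rewrite -(ler_pXn2r (n := 2)) ?nnegrE ?cmod_ge0 // sqr_cmod real_normK ?num_real //.
by rewrite lerDl sqr_ge0.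
Qed.

Lemma Im_le_cmod z : `|complex.Im z| <= cmod z.
Proof.
rewrite -(ler_pXn2r (n := 2)) ?nnegrE ?cmod_ge0 // sqr_cmod real_normK ?num_real //.
by rewrite lerDr sqr_ge0.
Qed.

Lemma cmod_sum (I : Type) (s : seq I) (f : I -> R[i]) :
  cmod (\sum_(i <- s) f i) <= \sum_(i <- s) cmod (f i).
Proof.
elim: s => [|i s IH]; first by rewrite !big_nil cmod0.
by rewrite !big_cons (le_trans (cmodD _ _)) // lerD2l.
Qed.

Lemma cmod_prod (I : Type) (s : seq I) (f : I -> R[i]) :
  cmod (\prod_(i <- s) f i) = \prod_(i <- s) cmod (f i).
Proof. by elim: s => [|i s IH]; rewrite ?big_nil ?cmod1 // !big_cons cmodM IH. Qed.

Lemma Re_add z w : complex.Re (z + w) = complex.Re z + complex.Re w.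
Proof. by case: z w => [a b] [c d]. Qed.

Lemma Re_sub z w : complex.Re (z - w) = complex.Re z - complex.Re w.
Proof. by case: z w => [a b] [c d]. Qed.

Lemma Im_sub z w : complex.Im (z - w) = complex.Im z - complex.Im w.
Proof. by case: z w => [a b] [c d]. Qed.

Lemma Re_mul z w : complex.Re (z * w) =
  complex.Re z * complex.Re w - complex.Im z * complex.Im w.
Proof. by case: z w => [a b] [c d]. Qed.

Lemma Im_mul z w : complex.Im (z * w) =
  complex.Re z * complex.Im w + complex.Im z * complex.Re w.
Proof. by case: z w => [a b] [c d]. Qed.

Lemma Re_sum (I : Type) (s : seq I) (P : pred I) (f : I -> R[i]) :
  complex.Re (\sum_(i <- s | P i) f i) = \sum_(i <- s | P i) complex.Re (f i).
Proof. exact: (big_morph _ Re_add erefl). Qed.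

Lemma Im_sum (I : Type) (s : seq I) (P : pred I) (f : I -> R[i]) :
  complex.Im (\sum_(i <- s | P i) f i) = \sum_(i <- s | P i) complex.Im (f i).
Proof. by apply: (big_morph _ _ erefl) => -[a b] [c d]. Qed.

Lemma Re_realM (x : R) z : complex.Re (x%:C * z) = x * complex.Re z.
Proof. by rewrite Re_mul mul0r subr0. Qed.

Lemma mulJc z : z * z^* = (cmod z ^+ 2)%:C.
Proof. by rewrite -sqr_normc cmod_normr rmorphXn. Qed.

End Modulus.

Section LogSeries.
Variable R : realType.
Implicit Types (z : R[i]) (t r : R).

(** The fraction is Re (z / (1 - t z)), half the derivative of - ln |1 - t z|^2 in t; the right-hand
    side is the remainder of its geometric series. *)
Let re_geometric z t N : t%:C * z != 1 ->
  (complex.Re z - t * cmod z ^+ 2) / cmod (1 - t%:C * z) ^+ 2 -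
    \sum_(n < N) t ^+ n * complex.Re (z ^+ n.+1) =
  complex.Re ((t%:C * z) ^+ N * z / (1 - t%:C * z)).
Proof.
move=> tz1; set w := t%:C * z.
have w1 : 1 - w != 0 by rewrite subr_eq0 eq_sym.
have -> : \sum_(n < N) t ^+ n * complex.Re (z ^+ n.+1) =
    complex.Re (z * \sum_(n < N) w ^+ n).
  rewrite mulr_sumr Re_sum; apply: eq_bigr => n _.
  by rewrite -Re_realM rmorphXn /= /w exprMn exprS; congr complex.Re; ring.
have -> : (complex.Re z - t * cmod z ^+ 2) / cmod (1 - w) ^+ 2 =
    complex.Re (z / (1 - w)).
  have -> : (1 - w)^-1 = ((cmod (1 - w) ^+ 2)^-1)%:C * (1 - w)^*.
    rewrite invc_norm cmod_normr fmorphV rmorphXn //.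
  rewrite [in RHS]mulrCA Re_realM mulrC; congr (_ * _).
  rewrite /w sqr_cmod; case: (z) => a b /=; ring.
rewrite -Re_sub; congr complex.Re; apply: (mulIf w1); rewrite mulfVK // mulrBl mulfVK //.
have -> : z * (\sum_(n < N) w ^+ n) * (1 - w) = z * - (w ^+ N - 1).
  by rewrite subrX1; ring.
by ring.
Qed.

(** The mean value theorem on [0, 1] for the error at t z as a function of the real variable t;
    working with the squared modulus avoids the complex logarithm. *)
Lemma ln_series z r N : cmod z <= r -> r < 1 ->
  `| - ln (cmod (1 - z) ^+ 2) -
     2 * \sum_(n < N) complex.Re (z ^+ n.+1) / n.+1%:R | <=
  2 * (r ^+ N.+1 / (1 - r)).
Proof.
move=> zr r1; have r0 : 0 <= r by exact: le_trans (cmod_ge0 z) zr.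
(* [q] is |1 - t z|^2 as a polynomial in t, and [p] is the partial sum at t z; its coefficient of
   index 0 vanishes because [0^-1 = 0]. *)
pose q : {poly R} := 1 - (2 * complex.Re z) *: 'X + cmod z ^+ 2 *: 'X^2.
pose p : {poly R} := \poly_(n < N.+1) (2 * complex.Re (z ^+ n) / n%:R).
have cz t : 0 <= t <= 1 -> cmod (t%:C * z) <= r.
  by move=> /andP[t0 t1]; rewrite cmodM cmod_real ger0_norm // -[leRHS]mul1r ler_pM // cmod_ge0.
have qE t : q.[t] = cmod (1 - t%:C * z) ^+ 2.
  rewrite !hornerE !sqr_cmod; case: (z) => a b /=; ring.
have c1 t : 0 <= t <= 1 -> 1 - r <= cmod (1 - t%:C * z).
  by move=> /cz h; have := cmodB 1 (t%:C * z); rewrite cmod1; lra.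
have q0 t : 0 <= t <= 1 -> 0 < q.[t].
  by move=> /c1 h; rewrite qE exprn_gt0 //; lra.
pose h t := - ln q.[t] - p.[t].
have dh t : 0 <= t <= 1 -> is_derive t (1 : R) h (- (q.[t]^-1 * q^`().[t]) - p^`().[t]).
  move=> t01; have := q0 t t01 => qt0.
  have dln := @is_derive1_ln R _ qt0.
  have dq : is_derive t (1 : R) (horner q) (q^`().[t]) by exact: is_derive_poly.
  have dc : is_derive t (1 : R) (@ln R \o horner q) (q.[t]^-1 * q^`().[t]).
    exact: is_derive1_comp.
  exact: is_deriveB.
have dhE t : 0 <= t <= 1 -> - (q.[t]^-1 * q^`().[t]) - p^`().[t] =
    2 * complex.Re ((t%:C * z) ^+ N * z / (1 - t%:C * z)).
  move=> t01; rewrite -re_geometric; last first.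
    apply/eqP => e; have := c1 t t01; rewrite e subrr cmod0; lra.
  have -> : p^`().[t] = 2 * \sum_(n < N) t ^+ n * complex.Re (z ^+ n.+1).
    rewrite /p; have -> : (\poly_(n < N.+1) (2 * complex.Re (z ^+ n) / n%:R))^`() =
        \poly_(n < N) (2 * complex.Re (z ^+ n.+1)).
      apply/polyP => j; rewrite coef_deriv !coef_poly ltnS; case: ifP => // _; last by rewrite mul0rn.
      by rewrite -[LHS]mulr_natr mulfVK // pnatr_eq0.
    by rewrite horner_poly mulr_sumr; apply: eq_bigr => n _; ring.
  rewrite qE mulrBr; congr (_ - _).
  have -> : q^`().[t] = - 2 * (complex.Re z - t * cmod z ^+ 2).
    by rewrite /q derivD derivB !derivZ derivX derivXn derivC !hornerE /=; ring.
  by ring.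
have in01 t : t \in `]0, 1[ -> 0 <= t <= 1.
  by rewrite in_itv /= => /andP[a b]; rewrite !ltW.
have [] := @MVT R h _ 0 1 ltr01 (fun t t01 => dh t (in01 t t01)).
  apply: derivable_within_continuous => t; rewrite in_itv /= => t01.
  by case: (dh t t01).
move=> c; rewrite in_itv /= => /andP[/ltW c0 /ltW c1'].
rewrite dhE ?c0 // subr0 mulr1 /h => e.
have p0 : p.[0] = 0 by rewrite horner_coef0 coef_poly /= invr0 mulr0.
have -> : - ln (cmod (1 - z) ^+ 2) -
     2 * \sum_(n < N) complex.Re (z ^+ n.+1) / n.+1%:R =
    - ln q.[1] - p.[1] - (- ln q.[0] - p.[0]).
  rewrite p0 !qE rmorph0 rmorph1 mul0r mul1r !subr0 cmod1 expr1n ln1 oppr0 subr0; congr (_ - _).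
  rewrite horner_poly big_ord_recl /= invr0 mulr0 mul0r add0r mulr_sumr.
  by apply: eq_bigr => n _; rewrite expr1n mulr1 mulrA.
rewrite e normrM gtr0_norm // ler_pM2l //; apply: le_trans (Re_le_cmod _) _.
rewrite !cmodM cmodX cmodV exprSr; apply: ler_pM.
- by rewrite mulr_ge0 ?exprn_ge0 ?cmod_ge0.
- by rewrite invr_ge0 cmod_ge0.
- by rewrite ler_pM ?exprn_ge0 ?cmod_ge0 // lerXn2r ?nnegrE ?cmod_ge0 // cz // c0.
- by rewrite lef_pV2 ?c1 ?c0 // posrE ?subr_gt0 // (lt_le_trans _ (c1 _ _)) ?c0 ?subr_gt0.
Qed.

End LogSeries.

(** * Positive definite kernels *)

Section BoundedMeasurable.
Context d (T : measurableType d) (R : realType).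
Implicit Types (u v : T -> R).

(** A class closed under sums and products whose members are integrable against every probability
    measure, so that linearity needs no further conditions. *)
Definition bmf u := measurable_fun setT u /\ exists M, forall x, `|u x| <= M.

Lemma bmf_cst c : bmf (fun=> c).
Proof. by split; [exact: measurable_cst | exists `|c|]. Qed.

Lemma bmfD u v : bmf u -> bmf v -> bmf (fun x => u x + v x).
Proof.
move=> [mu [M uM]] [mv [N vN]]; split; first exact: measurable_funD.
by exists (M + N) => x; rewrite (le_trans (ler_normD _ _)) // lerD.
Qed.

Lemma bmfM u v : bmf u -> bmf v -> bmf (fun x => u x * v x).
Proof.
move=> [mu [M uM]] [mv [N vN]]; split; first exact: measurable_funM.
by exists (M * N) => x; rewrite normrM ler_pM.
Qed.

Lemma bmfZ c u : bmf u -> bmf (fun x => c * u x).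
Proof. by move=> bu; apply: (@bmfM (fun=> c)) => //; exact: bmf_cst. Qed.

Lemma bmfB u v : bmf u -> bmf v -> bmf (fun x => u x - v x).
Proof.
move=> bu bv; have -> : (fun x => u x - v x) = (fun x => u x + -1 * v x).
  by apply/funext => x; rewrite mulN1r.
by apply: bmfD => //; exact: bmfZ.
Qed.

Lemma bmf_integrable (P : probability T R) u :
  bmf u -> P.-integrable setT (EFin \o u).
Proof.
move=> [mu [M uM]]; apply: measurable_bounded_integrable => //.
  by rewrite -ge0_fin_numE // fin_num_measure.
exists M; split; first exact: num_real.
by move=> N MN x _ /=; rewrite (le_trans (uM x)) // ltW.
Qed.

Lemma Rintegral_prob_cst (P : probability T R) c : \int[P]_x c = c :> R.
Proof. by rewrite Rintegral_cst // [X in fine X]probability_setT mulr1. Qed.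

End BoundedMeasurable.

Lemma bmf_comp d d' (S : measurableType d) (T : measurableType d') (R : realType)
    (u : T -> R) (g : S -> T) :
  measurable_fun setT g -> bmf u -> bmf (u \o g).
Proof.
move=> mg [mu [M uM]]; split; first exact: measurableT_comp.
by exists M => x; exact: uM.
Qed.

Section Kernels.
Context d (T : measurableType d) (R : realType).
Implicit Types (u v : T -> R) (K H : T -> T -> R).

(** Finite sums of kernels u(z) u(w): each summand contributes a square to the quadratic form, so
    positivity is an induction. *)
Inductive finite_rank : (T -> T -> R) -> Prop :=
| finite_rank0 : finite_rank (fun _ _ => 0)
| finite_rankS u K : bmf u -> finite_rank K ->
    finite_rank (fun z w => u z * u w + K z w).

Definition bkernel K := bmf (fun p : T * T => K p.1 p.2).

Lemma finite_rank_bkernel K : finite_rank K -> bkernel K.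
Proof.
elim=> [|u {}K bu _ IH]; first exact: bmf_cst.
apply: bmfD => //; apply: bmfM.
  exact: (bmf_comp measurable_fst bu).
exact: (bmf_comp measurable_snd bu).
Qed.

Lemma finite_rank1 u : bmf u -> finite_rank (fun z w => u z * u w).
Proof.
move=> bu; have := finite_rankS bu finite_rank0.
by congr finite_rank; apply/funext => z; apply/funext => w; rewrite addr0.
Qed.

Lemma finite_rankD K H : finite_rank K -> finite_rank H ->
  finite_rank (fun z w => K z w + H z w).
Proof.
move=> fK fH; elim: fK => [|u {}K bu _ IH].
  by move: fH; congr finite_rank; apply/funext => z; apply/funext => w; rewrite add0r.
have := finite_rankS bu IH.
by congr finite_rank; apply/funext => z; apply/funext => w; rewrite addrA.
Qed.

(** The Schur product theorem in its trivial case: the product of u(z) u(w) and v(z) v(w) is again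
    of this form, with the function u v. *)
Lemma finite_rankM K H : finite_rank K -> finite_rank H ->
  finite_rank (fun z w => K z w * H z w).
Proof.
move=> fK fH; elim: fK => [|u {}K bu _ IH].
  have := finite_rank0.
  by congr finite_rank; apply/funext => z; apply/funext => w; rewrite mul0r.
have uH : finite_rank (fun z w => u z * u w * H z w).
  elim: fH {IH} => [|v {}H bv _ IH].
    have := finite_rank0.
    by congr finite_rank; apply/funext => z; apply/funext => w; rewrite mulr0.
  have := finite_rankS (bmfM bu bv) IH.
  by congr finite_rank; apply/funext => z; apply/funext => w; ring.
have := finite_rankD uH IH.
by congr finite_rank; apply/funext => z; apply/funext => w; rewrite mulrDl.
Qed.

Lemma finite_rank_cst c : 0 <= c -> finite_rank (fun _ _ => c).
Proof.
move=> c0; have := finite_rank1 (bmf_cst T (Num.sqrt c)).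
by congr finite_rank; apply/funext => z; apply/funext => w; rewrite -expr2 sqr_sqrtr.
Qed.

(* Uniform limits of finite rank kernels form a class of positive definite
   kernels whose stability under products needs no spectral theory. *)
Definition pos_kernel K := forall e, 0 < e ->
  exists2 H, finite_rank H & forall z w, `|K z w - H z w| <= e.

Lemma finite_rank_pos K : finite_rank K -> pos_kernel K.
Proof. by move=> fK e e0; exists K => // z w; rewrite subrr normr0 ltW. Qed.

Lemma pos_kernel_bounded K : pos_kernel K -> exists M, forall z w, `|K z w| <= M.
Proof.
move=> /(_ 1 ltr01) [H fH KH]; have [_ [M HM]] := finite_rank_bkernel fH.
exists (1 + M) => z w; rewrite -(subrK (H z w) (K z w)) (le_trans (ler_normD _ _)) //.
by rewrite lerD // (HM (z, w)).
Qed.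

Lemma pos_kernelD K H : pos_kernel K -> pos_kernel H ->
  pos_kernel (fun z w => K z w + H z w).
Proof.
move=> pK pH e e0; have e2 : 0 < e / 2 by rewrite divr_gt0.
have [K' fK KK'] := pK _ e2; have [H' fH HH'] := pH _ e2.
exists (fun z w => K' z w + H' z w); first exact: finite_rankD.
move=> z w; rewrite opprD addrACA (le_trans (ler_normD _ _)) //.
by rewrite [leRHS](splitr e) lerD.
Qed.

Lemma pos_kernelM K H : pos_kernel K -> pos_kernel H ->
  pos_kernel (fun z w => K z w * H z w).
Proof.
move=> pK pH e e0.
have [M KM] := pos_kernel_bounded pK; have [N HN] := pos_kernel_bounded pH.
pose C := `|M| + `|N| + 1.
have C1 : 1 <= C by rewrite lerDr addr_ge0.
have C0 : 0 < C by apply: lt_le_trans C1.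
(* The error splits below into K (H - H'), (K - K') H and a quadratic term, bounded by C r, r C and,
   as r is at most 1, by r. *)
pose r := Num.min 1 (e / (C + C + 1)).
have D0 : 0 < C + C + 1 by rewrite addr_gt0 // addr_gt0.
have r0 : 0 < r by rewrite lt_min ltr01 divr_gt0.
have [K' fK KK'] := pK _ r0; have [H' fH HH'] := pH _ r0.
exists (fun z w => K' z w * H' z w); first exact: finite_rankM.
move=> z w.
have -> : K z w * H z w - K' z w * H' z w =
  K z w * (H z w - H' z w) + (K z w - K' z w) * H z w -
    (K z w - K' z w) * (H z w - H' z w) by ring.
have KC : `|K z w| <= C.
  by rewrite (le_trans (KM z w)) // (le_trans (ler_norm M)) // /C -addrA lerDl addr_ge0.
have HC : `|H z w| <= C.
  rewrite (le_trans (HN z w)) // (le_trans (ler_norm N)) // /C addrAC lerDr.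
  by rewrite addr_ge0.
have r1 : r <= 1 by rewrite /r ge_min lexx.
have re : r * (C + C + 1) <= e by rewrite -ler_pdivlMr // /r ge_min lexx orbT.
apply: le_trans re; rewrite (le_trans (ler_normB _ _)) //.
have -> : r * (C + C + 1) = (C * r + r * C) + r * 1 by ring.
have rr1 : `|H z w - H' z w| <= 1 by exact: le_trans (HH' z w) r1.
apply: lerD; last by rewrite normrM ler_pM.
by apply: le_trans (ler_normD _ _) _; apply: lerD; rewrite normrM ler_pM.
Qed.

Lemma pos_kernel_cst c : 0 <= c -> pos_kernel (fun _ _ => c).
Proof. by move=> c0; exact/finite_rank_pos/finite_rank_cst. Qed.

Lemma pos_kernelZ c K : 0 <= c -> pos_kernel K -> pos_kernel (fun z w => c * K z w).
Proof. by move=> c0; apply: (@pos_kernelM (fun _ _ => c)); exact: pos_kernel_cst. Qed.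

Lemma pos_kernelX n K : pos_kernel K -> pos_kernel (fun z w => K z w ^+ n).
Proof.
move=> pK; elim: n => [|n IH].
  by have := pos_kernel_cst ler01; congr pos_kernel; apply/funext => z; apply/funext => w.
have := pos_kernelM pK IH.
by congr pos_kernel; apply/funext => z; apply/funext => w; rewrite exprS.
Qed.

Lemma pos_kernel_sum (I : Type) (s : seq I) (f : I -> T -> T -> R) :
  (forall i, pos_kernel (f i)) -> pos_kernel (fun z w => \sum_(i <- s) f i z w).
Proof.
move=> pf; elim: s => [|i s IH].
  have := pos_kernel_cst (lexx 0).
  by congr pos_kernel; apply/funext => z; apply/funext => w; rewrite big_nil.
have := pos_kernelD (pf i) IH.
by congr pos_kernel; apply/funext => z; apply/funext => w; rewrite big_cons.
Qed.

Lemma pos_kernel_lim K :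
  (forall e, 0 < e -> exists2 H, pos_kernel H & forall z w, `|K z w - H z w| <= e) ->
  pos_kernel K.
Proof.
move=> lK e e0; have e2 : 0 < e / 2 by rewrite divr_gt0.
have [H /(_ _ e2)[H' fH HH'] KH] := lK _ e2.
exists H' => // z w; rewrite -(subrKA (H z w)) (le_trans (ler_normD _ _)) //.
by rewrite [leRHS](splitr e) lerD.
Qed.

End Kernels.

Section QuadraticForm.
Context d (T : measurableType d) (R : realType).
Variables (P Q : probability T R) (t : R).
Implicit Types (u : T -> R) (K H : T -> T -> R).

Definition mutual (P Q : probability T R) K : R :=
  \int[(P \x Q)%E]_p K p.1 p.2.

Lemma mutualD (A B : probability T R) K H : bkernel K -> bkernel H ->
  mutual A B (fun z w => K z w + H z w) = mutual A B K + mutual A B H.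
Proof. by move=> bK bH; apply: RintegralD => //; exact: bmf_integrable. Qed.

Lemma mutual_rank1 (A B : probability T R) u : bmf u ->
  mutual A B (fun z w => u z * u w) = (\int[A]_x u x) * (\int[B]_x u x).
Proof.
move=> bu.
have bK : bkernel (fun z w => u z * u w) by exact/finite_rank_bkernel/finite_rank1.
rewrite /mutual /Rintegral -integral12_prod_meas1; last exact: (bmf_integrable _ bK).
rewrite -/(Rintegral A setT _) /fubini_F /=.
have -> : (fun x => \int[B]_y (u x * u y)%:E)%E = (fun x => (u x * \int[B]_y u y)%:E).
  apply/funext => x; under eq_integral do rewrite EFinM.
  rewrite integralZl //; last exact: bmf_integrable.
  rewrite EFinM; congr (_ * _)%E; rewrite fineK //.
  exact: integrable_fin_num (bmf_integrable _ bu).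
exact: (@RintegralZr _ _ _ A setT u _ measurableT (bmf_integrable _ bu)).
Qed.

Lemma mutual_close (A B : probability T R) K H e : bkernel K -> bkernel H ->
  (forall z w, `|K z w - H z w| <= e) -> `|mutual A B K - mutual A B H| <= e.
Proof.
move=> bK bH KH; have bKH := bmfB bK bH.
have iKH := bmf_integrable (A \x B)%E bKH.
rewrite /mutual -RintegralB //; try exact: bmf_integrable.
apply: le_trans (le_normr_Rintegral measurableT iKH) _.
rewrite -[leRHS](Rintegral_prob_cst (A \x B)%E) le_Rintegral //.
- exact: (integrable_norm iKH).
- exact: (bmf_integrable _ (bmf_cst _ e)).
Qed.

(** The value at [K] of the quadratic form of the signed measure P - t Q, expanded into four mutual
    energies of probability measures. *)
Definition quad_form K :=
  mutual P P K - t * (mutual P Q K + mutual Q P K) + t ^+ 2 * mutual Q Q K.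

Lemma quad_formD K H : bkernel K -> bkernel H ->
  quad_form (fun z w => K z w + H z w) = quad_form K + quad_form H.
Proof. by move=> bK bH; rewrite /quad_form !mutualD //; ring. Qed.

Lemma quad_form_rank1 u : bmf u ->
  quad_form (fun z w => u z * u w) = (\int[P]_x u x - t * \int[Q]_x u x) ^+ 2.
Proof. by move=> bu; rewrite /quad_form !mutual_rank1 //; ring. Qed.

Lemma quad_form_finite_rank_ge0 K : finite_rank K -> 0 <= quad_form K.
Proof.
elim=> [|u {}K bu fK IH].
  have e0 (A B : probability T R) : mutual A B (fun _ _ => 0) = 0.
    exact: Rintegral_prob_cst.
  by rewrite /quad_form !e0; lra.
rewrite quad_formD ?quad_form_rank1 //; last exact: finite_rank_bkernel.
  by rewrite addr_ge0 // sqr_ge0.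
exact/finite_rank_bkernel/finite_rank1.
Qed.

Lemma quad_form_ge0 K : bkernel K -> pos_kernel K -> 0 <= quad_form K.
Proof.
move=> bK pK; rewrite leNgt; apply/negP => n0.
(* [c] is (1 + |t|)^2: changing the kernel by at most e changes the form by at most [c * e], and e
   is chosen to make this half of the supposed negative value. *)
pose c := 1 + 2 * `|t| + t ^+ 2.
have c0 : 0 < c by rewrite /c ltr_pwDl ?sqr_ge0 // ltr_pwDl // mulr_ge0.
have e0 : 0 < - quad_form K / (c + c) by rewrite divr_gt0 ?oppr_gt0 // addr_gt0.
have [H fH KH] := pK _ e0; have bH := finite_rank_bkernel fH.
have cl A B := mutual_close A B bK bH KH.
have := quad_form_finite_rank_ge0 fH.
suff : quad_form H - quad_form K <= c * (- quad_form K / (c + c)).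
  have -> : c * (- quad_form K / (c + c)) = - quad_form K / 2 by field; rewrite gt_eqF //; lra.
  lra.
set e := - quad_form K / _ in cl *.
have -> : quad_form H - quad_form K = (mutual P P H - mutual P P K)
   + (- t * (mutual P Q H - mutual P Q K) + - t * (mutual Q P H - mutual Q P K))
   + t ^+ 2 * (mutual Q Q H - mutual Q Q K) by rewrite /quad_form; ring.
have -> : c * e = e + (`|t| * e + `|t| * e) + t ^+ 2 * e by rewrite /c; ring.
have cl' A B : `|mutual A B H - mutual A B K| <= e by rewrite distrC.
rewrite lerD // ?lerD // (le_trans (ler_norm _)) // normrM ?normrN ler_pM //.
by rewrite ger0_norm // sqr_ge0.
Qed.

End QuadraticForm.

Lemma small_power (R : realType) (q e : R) : 0 <= q < 1 -> 0 < e ->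
  exists N, q ^+ N <= e.
Proof.
move=> /andP[q0 q1] e0.
have := @cvg_expr R q; rewrite ger0_norm // => /(_ q1) /cvgr0Pnorm_le /(_ e e0) [N _ HN].
by exists N; have /= := HN N (leqnn N); rewrite ger0_norm // exprn_ge0.
Qed.

Section LogKernel.
Context d (T : measurableType d) (R : realType).
Variable a : T -> R[i].

Definition cbmf (h : T -> R[i]) :=
  bmf (fun z => complex.Re (h z)) /\ bmf (fun z => complex.Im (h z)).

Lemma cbmfM g h : cbmf g -> cbmf h -> cbmf (fun z => g z * h z).
Proof.
move=> [gr gi] [hr hi]; split.
  under eq_fun do rewrite Re_mul; apply: bmfB; exact: bmfM.
under eq_fun do rewrite Im_mul; apply: bmfD; exact: bmfM.
Qed.

Lemma cbmfX h n : cbmf h -> cbmf (fun z => h z ^+ n).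
Proof.
move=> bh; elim: n => [|n IH].
  by split; exact: bmf_cst.
by under eq_fun do rewrite exprS; exact: cbmfM.
Qed.

Lemma cbmfJ h : cbmf h -> cbmf (fun z => (h z)^*).
Proof.
move=> [hr hi]; split.
  by move: hr; congr bmf; apply/funext => z; case: (h z).
have := bmfZ (-1) hi.
by congr bmf; apply/funext => z; case: (h z) => x y /=; rewrite mulN1r.
Qed.

Let Re_mulJ (x y : R[i]) : complex.Re (x * y^*) =
  complex.Re x * complex.Re y + complex.Im x * complex.Im y.
Proof. by case: x y => [x1 x2] [y1 y2] /=; ring. Qed.

Lemma finite_rank_ReJ h : cbmf h ->
  finite_rank (fun z w => complex.Re (h z * (h w)^*)).
Proof.
move=> [hr hi]; have := finite_rankD (finite_rank1 hr) (finite_rank1 hi).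
by congr finite_rank; apply/funext => z; apply/funext => w; rewrite Re_mulJ.
Qed.

Lemma quad_form_ReJ (P Q : probability T R) (t : R) h : cbmf h ->
  quad_form P Q t (fun z w => complex.Re (h z * (h w)^*)) =
  (\int[P]_z complex.Re (h z) - t * \int[Q]_z complex.Re (h z)) ^+ 2 +
  (\int[P]_z complex.Im (h z) - t * \int[Q]_z complex.Im (h z)) ^+ 2.
Proof.
move=> [hr hi]; rewrite -!quad_form_rank1 // -quad_formD; try exact/finite_rank_bkernel/finite_rank1.
by congr quad_form; apply/funext => z; apply/funext => w; rewrite Re_mulJ.
Qed.

Hypothesis a_bmf : cbmf a.
Hypothesis a_half : forall z, cmod (a z) <= 2^-1.

Let zeta z w : R[i] := a z * (a w)^*.

Let zeta_le z w : cmod (zeta z w) <= 4^-1.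
Proof.
rewrite cmodM cmodJ; have -> : 4^-1 = 2^-1 * 2^-1 :> R by lra.
by rewrite ler_pM ?cmod_ge0.
Qed.

Let dist1_zeta z w : 3 / 4 <= cmod (1 - zeta z w).
Proof. by have := cmodB 1 (zeta z w); rewrite cmod1; have := zeta_le z w; lra. Qed.

Let zetaX z w n : zeta z w ^+ n = a z ^+ n * (a w ^+ n)^*.
Proof. by rewrite /zeta exprMn rmorphXn. Qed.

(** The subtracted kernel is the k-th term of the power series of - ln |1 - zeta|^2; the other terms
    have nonnegative coefficients and remain. *)
Let pos_log_zeta k : (0 < k)%N ->
  pos_kernel (fun z w => - ln (cmod (1 - zeta z w) ^+ 2)
    - 2 / k%:R * complex.Re (a z ^+ k * (a w ^+ k)^*)).
Proof.
move=> k0; apply: pos_kernel_lim => e e0.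
have [N0 HN0] : exists N, (4^-1 : R) ^+ N <= e / 4.
  by apply: small_power; [lra | rewrite divr_gt0].
(* Adding [k] makes sure that the k-th term belongs to the partial sum. With r = 1/4 the remainder
   is at most (8/3) (1/4)^(N + 1), whence the bound e / 4. *)
pose N := (N0 + k)%N.
exists (fun z w => \sum_(n < N | n.+1 != k) 2 / n.+1%:R * complex.Re (a z ^+ n.+1 * (a w ^+ n.+1)^*)).
  have pf (n : 'I_N) : pos_kernel (fun z w => 2 / n.+1%:R *
      complex.Re (a z ^+ n.+1 * (a w ^+ n.+1)^*)).
    apply: pos_kernelZ; first by rewrite divr_ge0.
    exact/finite_rank_pos/finite_rank_ReJ/cbmfX.
  have := pos_kernel_sum (seq.filter (fun n : 'I_N => n.+1 != k) (index_enum 'I_N)) pf.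
  by congr pos_kernel; apply/funext => z; apply/funext => w; rewrite big_filter.
move=> z w; have r1 : (4^-1 : R) < 1 by lra.
have kN : (k.-1 < N)%N by rewrite /N; lia.
have := ln_series N (zeta_le z w) r1.
rewrite mulr_sumr (bigD1 (Ordinal kN)) //= prednK //.
have -> : \sum_(i < N | i != Ordinal kN) 2 * (complex.Re (zeta z w ^+ i.+1) / i.+1%:R) =
   \sum_(n < N | n.+1 != k) 2 / n.+1%:R * complex.Re (a z ^+ n.+1 * (a w ^+ n.+1)^*).
  apply: eq_big => i; first by rewrite -val_eqE /=; lia.
  by move=> _; rewrite -zetaX; ring.
rewrite -zetaX => H.
rewrite (_ : _ - _ - _ = - ln (cmod (1 - zeta z w) ^+ 2) -
   (2 * (complex.Re (zeta z w ^+ k) / k%:R) +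
    \sum_(n < N | n.+1 != k) 2 / n.+1%:R * complex.Re (a z ^+ n.+1 * (a w ^+ n.+1)^*))); last by ring.
apply: le_trans H _.
have : (4^-1 : R) ^+ N.+1 <= e / 4.
  apply: le_trans HN0; apply: ler_wiXn2l; rewrite ?invr_ge0 ?invf_le1 ?ler1n // /N; lia.
rewrite ler_pdivlMr; last by lra.
move=> h; rewrite mulrA ler_pdivrMr; last by lra.
by rewrite /= in h *; lra.
Qed.

(** 1 / |1 - c|^2 is the limit of the squared modulus of the geometric sum S of c; expanding S times
    its conjugate gives kernels h(z) conj(h(w)) with h = a^i conj(a)^j. *)
Let pos_invsq_zeta : pos_kernel (fun z w => (cmod (1 - zeta z w) ^+ 2)^-1).
Proof.
apply: pos_kernel_lim => e e0.
(* The error is at most 3 (1/4)^M / |1 - c|^2 with |1 - c| at least 3/4, and 3/6 is less than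
   (3/4)^2. *)
have [M HM] : exists N, (4^-1 : R) ^+ N <= e / 6.
  by apply: small_power; [lra | rewrite divr_gt0].
pose h i j z := a z ^+ i * (a z)^* ^+ j.
exists (fun z w => \sum_(i < M) \sum_(j < M) complex.Re (h i j z * (h i j w)^*)).
  apply: pos_kernel_sum => i; apply: pos_kernel_sum => j.
  apply/finite_rank_pos/finite_rank_ReJ/cbmfM; first exact: cbmfX.
  exact/cbmfX/cbmfJ.
move=> z w; set c := zeta z w; pose S := \sum_(i < M) c ^+ i.
have -> : \sum_(i < M) \sum_(j < M) complex.Re (h i j z * (h i j w)^*) = cmod S ^+ 2.
  have -> : cmod S ^+ 2 = complex.Re (S * S^*) by rewrite mulJc.
  rewrite rmorph_sum /= mulr_suml Re_sum; apply: eq_bigr => i _.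
  rewrite mulr_sumr Re_sum; apply: eq_bigr => j _; congr complex.Re.
  rewrite /h /c /zeta !rmorphM !rmorphXn /=.
  by rewrite rmorphM /= conjCK !exprMn; ring.
have c1 : 1 - c != 0.
  by rewrite -cmod_gt0 (lt_le_trans _ (dist1_zeta z w)) //; lra.
have SE : cmod S = cmod (1 - c ^+ M) / cmod (1 - c).
  apply: (mulIf (_ : cmod (1 - c) != 0)); first by rewrite cmod_eq0.
  rewrite mulfVK ?cmod_eq0 // -cmodM; congr cmod.
  by rewrite -[RHS]opprB subrX1 -/S; ring.
have d0 : 0 < cmod (1 - c) by rewrite cmod_gt0.
rewrite SE expr_div_n -[X in X - _]mul1r -mulrBl normrM normfV.
rewrite [`|cmod _ ^+ 2|]ger0_norm ?sqr_ge0 // ler_pdivrMr ?exprn_gt0 //.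
have q0 : cmod (c ^+ M) <= 4^-1 ^+ M.
  by rewrite cmodX lerXn2r ?nnegrE ?cmod_ge0 // ?invr_ge0 // zeta_le.
have q1 : (4^-1 : R) ^+ M <= 1 by rewrite exprn_ile1 //; lra.
have u1 : cmod (1 - c ^+ M) <= 1 + 4^-1 ^+ M.
  by have := cmodD 1 (- c ^+ M); rewrite cmodN cmod1; lra.
have u2 : 1 - 4^-1 ^+ M <= cmod (1 - c ^+ M).
  by have := cmodB 1 (c ^+ M); rewrite cmod1; lra.
have dd : (3 / 4) ^+ 2 <= cmod (1 - c) ^+ 2.
  by rewrite lerXn2r ?nnegrE ?cmod_ge0 ?dist1_zeta //; lra.
have : `|1 - cmod (1 - c ^+ M) ^+ 2| <= 3 * 4^-1 ^+ M.
  by rewrite ler_norml; apply/andP; split; nra.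
move=> H; apply: le_trans H _.
apply: (@le_trans _ _ (3 * (e / 6))); first by rewrite ler_pM2l.
by nra.
Qed.

Let wt z : R := 1 - cmod (a z) ^+ 2.

Lemma weight_bounds z : 3 / 4 <= 1 - cmod (a z) ^+ 2 <= 1.
Proof.
have h : cmod (a z) ^+ 2 <= 2^-1 ^+ 2.
  by rewrite lerXn2r ?nnegrE ?cmod_ge0 ?invr_ge0.
by rewrite lerBlDr lerDl sqr_ge0 andbT; move: h; rewrite expr2 => h; rewrite /= in h *; lra.
Qed.

(** The identity behind the pseudo-hyperbolic distance: it shows that 1 - [ratio] is |a z - a w|^2 /
    |1 - zeta|^2, hence that [ratio] is at most 1. *)
Let dist_zeta z w :
  cmod (1 - zeta z w) ^+ 2 = cmod (a z - a w) ^+ 2 + wt z * wt w.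
Proof.
rewrite /wt /zeta !sqr_cmod; case: (a z) (a w) => [x y] [u v] /=; ring.
Qed.

Let ratio z w := wt z * wt w / cmod (1 - zeta z w) ^+ 2.

Let ratio_bounds z w : 0 <= ratio z w <= 1.
Proof.
have d0 : 0 < cmod (1 - zeta z w) ^+ 2.
  by rewrite exprn_gt0 // (lt_le_trans _ (dist1_zeta z w)) //; lra.
have /andP[z0 _] := weight_bounds z; have /andP[w0 _] := weight_bounds w.
rewrite /ratio divr_ge0 ?(ltW d0) ?mulr_ge0 //; try by rewrite /wt; lra.
by rewrite ler_pdivrMr // mul1r dist_zeta lerDr sqr_ge0.
Qed.

Let bmf_wt : bmf wt.
Proof.
have [ar ai] := a_bmf.
have := bmfB (bmf_cst T 1) (bmfD (bmfM ar ar) (bmfM ai ai)).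
by congr bmf; apply/funext => z; rewrite /wt sqr_cmod !expr2.
Qed.

Let pos_ratio : pos_kernel ratio.
Proof. exact: pos_kernelM (finite_rank_pos (finite_rank1 bmf_wt)) pos_invsq_zeta. Qed.

(** Since [ratio] equals 1 on the diagonal, the series of - ln (1 - x) converges uniformly only
    after the factor [s < 1] is inserted. *)
Let pos_log_ratio s : 0 <= s < 1 ->
  pos_kernel (fun z w => - ln (1 - s * ratio z w)).
Proof.
move=> /andP[s0 s1]; apply: pos_kernel_lim => e e0.
have [N HN] : exists N, s ^+ N <= e * (1 - s).
  by apply: small_power; rewrite ?s0 // mulr_gt0 // subr_gt0.
exists (fun z w => \sum_(n < N) (s ^+ n.+1 / n.+1%:R) * ratio z w ^+ n.+1).
  apply: pos_kernel_sum => n; apply: pos_kernelZ; last exact: pos_kernelX.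
  by rewrite divr_ge0 // exprn_ge0.
move=> z w; have /andP[r0 r1] := ratio_bounds z w.
have sr0 : 0 <= s * ratio z w by rewrite mulr_ge0.
have srs : s * ratio z w <= s by rewrite ler_piMr.
(* At a real point [ln_series] is about ln of a square, so both sides carry a factor 2 that
   cancels. *)
have := @ln_series R (s * ratio z w)%:C s N.
rewrite cmod_real ger0_norm // => /(_ srs s1).
have -> : cmod (1 - (s * ratio z w)%:C) = 1 - s * ratio z w.
  by rewrite -(rmorph1 (real_complex R)) -rmorphB cmod_real ger0_norm // subr_ge0; lra.
rewrite lnXn; last by lra.
have -> : \sum_(n < N) complex.Re ((s * ratio z w)%:C ^+ n.+1) / n.+1%:R =
   \sum_(n < N) (s ^+ n.+1 / n.+1%:R) * ratio z w ^+ n.+1.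
  by apply: eq_bigr => n _; rewrite -rmorphXn /= exprMn; ring.
have -> x y : - (ln x *+ 2) - 2 * y = 2 * (- ln x - y) :> R by rewrite -mulr_natl; ring.
rewrite normrM gtr0_norm // ler_pM2l // => H; apply: le_trans H _.
rewrite ler_pdivrMr ?subr_gt0 //; apply: le_trans HN.
by rewrite exprS ler_piMl ?exprn_ge0 // ltW.
Qed.

(* The argument of [ln] equals [|1 - a z (a w)^*|^2 (1 - (1 - e) ratio z w)]: this
   is the regularization of [- ln |a z - a w|^2] for which the logarithm expands
   into positive definite kernels. *)
Definition log_kernel (e : R) z w :=
  - ln (cmod (a z - a w) ^+ 2 +
        e * ((1 - cmod (a z) ^+ 2) * (1 - cmod (a w) ^+ 2))).

Lemma log_kernel_arg e z w : 0 < e <= 1 ->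
  e * (3 / 4) ^+ 2 <= cmod (a z - a w) ^+ 2 +
        e * ((1 - cmod (a z) ^+ 2) * (1 - cmod (a w) ^+ 2)) <= 2.
Proof.
move=> /andP[e0 e1].
have /andP[z0 z1] := weight_bounds z; have /andP[w0 w1] := weight_bounds w.
have d2 : cmod (a z - a w) ^+ 2 <= 1.
  rewrite expr_le1 ?cmod_ge0 //; have := cmodD (a z) (- a w); rewrite cmodN.
  by have := a_half z; have := a_half w; lra.
have d0 : 0 <= cmod (a z - a w) ^+ 2 by rewrite sqr_ge0.
move: z0 z1 w0 w1 d2 d0; set A := 1 - _; set B := 1 - _; set C := _ ^+ 2.
move=> z0 z1 w0 w1 d2 d0.
have AB1 : A * B <= 1 by nra.
have AB0 : (3 / 4) ^+ 2 <= A * B by rewrite expr2; nra.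
apply/andP; split; last by nra.
by rewrite -[leLHS]add0r lerD // ler_pM2l.
Qed.

Lemma log_kernel_bkernel e : 0 < e <= 1 -> bkernel (log_kernel e).
Proof.
move=> e01; have [[ar _] [ai _]] := a_bmf; split; last first.
  exists (`|ln (e * (3 / 4) ^+ 2)| + `|ln (2 : R)|) => -[z w] /=.
  have /andP[lo hi] := log_kernel_arg z w e01.
  have lo0 : 0 < e * (3 / 4) ^+ 2 by case/andP: e01 => e0 _; rewrite mulr_gt0 //; lra.
  rewrite /log_kernel normrN; move: lo hi; set X := _ + _ => lo hi.
  have X0 := lt_le_trans lo0 lo.
  have hl : ln (e * (3 / 4) ^+ 2) <= ln X by rewrite ler_ln ?posrE.
  have hh : ln X <= ln 2 by rewrite ler_ln ?posrE.
  have := ler_norm (ln (2 : R)); have := ler_norm (- ln (e * (3 / 4) ^+ 2)).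
  rewrite normrN ler_norml; have := normr_ge0 (ln (2:R)).
  have := normr_ge0 (ln (e * (3 / 4) ^+ 2)).
  by move=> *; apply/andP; split; lra.
have mrr (f : T -> R) : measurable_fun setT f ->
    measurable_fun setT (fun p : T * T => f p.1) /\
    measurable_fun setT (fun p : T * T => f p.2).
  by move=> mf; split; apply: measurableT_comp.
have [ar1 ar2] := mrr _ ar; have [ai1 ai2] := mrr _ ai.
rewrite /log_kernel; apply: measurable_funN; apply: measurableT_comp => //.
under eq_fun do rewrite !sqr_cmod !Re_sub !Im_sub.
apply: measurable_funD.
  by apply: measurable_funD; apply: measurable_funX; apply: measurable_funB.
apply: measurable_funM => //; apply: measurable_funM; apply: measurable_funB => //;
  by apply: measurable_funD; apply: measurable_funX.
Qed.

Lemma log_kernel_pos e k : 0 < e <= 1 -> (0 < k)%N ->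
  pos_kernel (fun z w => log_kernel e z w
    - 2 / k%:R * complex.Re (a z ^+ k * (a w ^+ k)^*)).
Proof.
move=> /andP[e0 e1] k0.
have s01 : 0 <= 1 - e < 1 by apply/andP; split; lra.
have := pos_kernelD (pos_log_zeta k0) (pos_log_ratio s01).
congr pos_kernel; apply/funext => z; apply/funext => w.
have d0 : 0 < cmod (1 - zeta z w) ^+ 2.
  by rewrite exprn_gt0 // (lt_le_trans _ (dist1_zeta z w)) //; lra.
have /andP[r0 r1] := ratio_bounds z w.
rewrite addrAC /log_kernel; congr (_ - _); rewrite -opprD -lnM ?posrE //; last first.
  by have : (1 - e) * ratio z w <= 1 - e; [rewrite ler_piMr //; lra | lra].
congr (- ln _); rewrite mulrBr mulr1 /ratio mulrCA [X in _ * X]mulrCA mulfV ?gt_eqF //.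
by rewrite mulr1 dist_zeta /wt; ring.
Qed.

(** A quantitative positive definiteness: the k-th term split off from the series contributes
    exactly the squared distance between the k-th moments of P and t Q, and the rest of the form is
    nonnegative. *)
Lemma quad_form_log_kernel (P Q : probability T R) (t e : R) k : 0 < e <= 1 -> (0 < k)%N ->
  2 / k%:R * ((\int[P]_z complex.Re (a z ^+ k) - t * \int[Q]_z complex.Re (a z ^+ k)) ^+ 2 +
    (\int[P]_z complex.Im (a z ^+ k) - t * \int[Q]_z complex.Im (a z ^+ k)) ^+ 2)
  <= quad_form P Q t (log_kernel e).
Proof.
move=> e01 k0; have bL := log_kernel_bkernel e01.
have fk := finite_rank_ReJ (cbmfX k a_bmf).
have bk := bmfZ (2 / k%:R) (finite_rank_bkernel fk).
have fE : quad_form P Q t (fun z w => 2 / k%:R * complex.Re (a z ^+ k * (a w ^+ k)^*)) =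
    2 / k%:R * quad_form P Q t (fun z w => complex.Re (a z ^+ k * (a w ^+ k)^*)).
  rewrite /quad_form /mutual !RintegralZl //; try exact: bmf_integrable (finite_rank_bkernel fk).
  by ring.
rewrite -(quad_form_ReJ P Q t (cbmfX k a_bmf)) -fE.
have bLk : bkernel (fun z w => log_kernel e z w
    - 2 / k%:R * complex.Re (a z ^+ k * (a w ^+ k)^*)) := bmfB bL bk.
have := quad_form_ge0 P Q t bLk (log_kernel_pos e01 k0).
rewrite -(lerD2r (quad_form P Q t (fun z w => 2 / k%:R * complex.Re (a z ^+ k * (a w ^+ k)^*)))).
rewrite add0r -quad_formD // => /le_trans; apply; rewrite le_eqVlt; apply/orP; left.
apply/eqP; congr quad_form; apply/funext => z; apply/funext => w.
by rewrite subrK.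
Qed.

End LogKernel.

(** * Continuity of the roots *)

Section ComplexTopology.
Variable R : realType.
Local Notation C := (R[i]^o).

Lemma nbhs_cmod (x : C) (U : set C) :
  nbhs x U <-> exists2 e : R, 0 < e & forall y : C, cmod ((y : R[i]) - x) < e -> U y.
Proof.
split.
  move=> /nbhs_ballP [[e e']]; rewrite /= ltcE /= => /andP[/eqP e'0 e0].
  rewrite {}e'0 => bU; exists e => // y xy; apply: bU; rewrite -ball_normE /= distrC.
  by rewrite cmod_normr ltcR.
move=> [e e0 bU]; apply/nbhs_ballP; exists e%:C; first by rewrite /= ltcR.
move=> y; rewrite -ball_normE /= distrC cmod_normr ltcR; exact: bU.
Qed.

Lemma open_cmod (U : set C) : open U <->
  forall x, U x -> exists2 e : R, 0 < e & forall y : C, cmod ((y : R[i]) - x) < e -> U y.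
Proof.
rewrite openE; split => [oU x Ux|oU x Ux]; first exact/nbhs_cmod/oU.
exact/nbhs_cmod/oU.
Qed.

Lemma cvgM_complex (T : Type) (G : set_system T) {FG : Filter G} (f g : T -> C) (x y : C) :
  f @ G --> x -> g @ G --> y -> (fun t => f t * g t : C) @ G --> (x * y : C).
Proof.
move=> fx gy; have := @mul_continuous R[i] (x, y).
move=> mc; exact: (cvg_comp2 fx gy mc).
Qed.

Lemma cvgD_complex (T : Type) (G : set_system T) {FG : Filter G} (f g : T -> C) (x y : C) :
  f @ G --> x -> g @ G --> y -> (fun t => f t + g t : C) @ G --> (x + y : C).
Proof. exact: cvgD. Qed.

Lemma continuous_horner_complex (F : {poly R[i]}) :
  continuous (horner F : C -> C).
Proof.
elim/poly_ind: F => [|p c IH] z.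
  have -> : (horner 0 : C -> C) = cst 0 by apply/funext => y; rewrite horner0.
  exact: cst_continuous.
have -> : (horner (p * 'X + c%:P) : C -> C) = (fun y => (p.[y] : C) * (y : C) + (c : C)).
  by apply/funext => y; rewrite !hornerE.
have Fz : Filter (nbhs (z : C)) by exact: nbhs_filter.
have h := cvgM_complex (FG := Fz) (IH z) (@cvg_id _ (nbhs z)).
exact: (cvgD_complex (FG := Fz) h (@cvg_cst _ (c : C) _ _ Fz)).
Qed.

Lemma measurable_lipschitz (f : R[i] -> R) :
  (forall x y, `|f x - f y| <= cmod (x - y)) ->
  measurable_fun setT (f : borelC R -> R).
Proof.
move=> lf; apply: (measurability _ (RGenOInfty.measurableE R)) => _ [_ [r ->] <-].
rewrite setTI; apply: sub_sigma_algebra; apply/open_cmod => x /=.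
rewrite in_itv /= andbT => rx; exists (f x - r); first by rewrite subr_gt0.
move=> y xy; rewrite in_itv /= andbT; have := lf x y; rewrite cmod_distC => h.
by have := ler_norm (f x - f y); lra.
Qed.

Lemma measurable_Re : measurable_fun setT (@complex.Re R : borelC R -> R).
Proof. by apply: measurable_lipschitz => x y; rewrite -Re_sub Re_le_cmod. Qed.

Lemma measurable_Im : measurable_fun setT (@complex.Im R : borelC R -> R).
Proof. by apply: measurable_lipschitz => x y; rewrite -Im_sub Im_le_cmod. Qed.

Lemma measurable_cmod : measurable_fun setT (@cmod R : borelC R -> R).
Proof.
apply: measurable_lipschitz => x y; rewrite ler_norml cmodB andbT.
by have := cmodB y x; rewrite cmod_distC; lra.
Qed.

Lemma measurable_horner (F : {poly R[i]}) :
  measurable_fun setT (horner F : borelC R -> borelC R).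
Proof.
apply: (@measurability _ _ (borelC R) (borelC R) _ _ (@open C)) => // _ [U oU <-].
rewrite setTI; apply: sub_sigma_algebra.
by apply: open_comp => // z _; exact: continuous_horner_complex.
Qed.

(** Squares are used in place of discs because they are continuous images of products of
    segments. *)
Lemma compact_square (x y r : R) :
  compact [set z : C | x - r <= complex.Re z <= x + r /\ y - r <= complex.Im z <= y + r].
Proof.
pose g := fun p : R^o * R^o => (p.1 +i* p.2 : C).
have -> : [set z : C | x - r <= complex.Re z <= x + r /\ y - r <= complex.Im z <= y + r] =
    g @` (`[x - r, x + r] `*` `[y - r, y + r]).
  apply/seteqP; split => [z [hx hy]|_ [[u v] [hu hv] <-]].
    exists (complex.Re z, complex.Im z); last by case: (z).
    by split; rewrite /= in_itv.
  by move: hu hv; rewrite /= !in_itv.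
apply: continuous_compact; last first.
  by apply: compact_setX; exact: segment_compact.
apply: continuous_subspaceT => p U /nbhs_cmod [e e0 eU].
have e2 : 0 < e / 2 by rewrite divr_gt0.
exists (ball p.1 (e / 2), ball p.2 (e / 2)); first by split; exact: nbhsx_ballx.
move=> [u v] [/= hu hv]; apply: eU.
have -> : (g (u, v) : R[i]) - g p = (u - p.1)%:C + 'i%C * (v - p.2)%:C.
  by apply/eqP; rewrite eq_complex /=; apply/andP; split; apply/eqP; ring.
apply: le_lt_trans (cmodD _ _) _; rewrite cmodM !cmod_real.
have -> : cmod ('i%C : R[i]) = 1 by rewrite /cmod /= expr0n /= expr1n add0r sqrtr1.
by move: hu hv; rewrite -!ball_normE /= ![`|p.1 - _|]distrC ![`|p.2 - _|]distrC; lra.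
Qed.

End ComplexTopology.

Section RootContinuity.
Variables (R : realType) (F : {poly R[i]}).
Hypothesis F_gt1 : (1 < size F)%N.
Local Notation C := (R[i]^o).
Local Notation D := (size F).-1.

Let lead_neq0 : lead_coef F != 0.
Proof. by rewrite lead_coef_eq0 -size_poly_gt0 ltnW. Qed.

(** |F(z) - w0| is |lead| times the product of the distances from z to the fibre of w0, so these D
    distances cannot all be at least e. *)
Lemma root_near (w0 w z : R[i]) e : 0 < e -> F.[z] = w ->
  cmod (w - w0) < cmod (lead_coef F) * e ^+ D ->
  exists2 x, x \in fibre F w0 & cmod (z - x) < e.
Proof.
move=> e0 Fz lt_w; apply: contrapT => nex.
have far x : x \in fibre F w0 -> e <= cmod (z - x).
  by move=> xf; rewrite leNgt; apply/negP => lt_e; apply: nex; exists x.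
move: lt_w; rewrite -Fz (horner_fibre F_gt1) cmodM ltr_pM2l ?cmod_gt0 //.
rewrite cmod_prod ltNge => /negP; apply.
have -> : e ^+ D = \prod_(x <- fibre F w0) e.
  by rewrite big_const_seq count_predT iter_mulr_1 size_fibre.
rewrite big_seq [leRHS]big_seq.
by apply: ler_prod => x xf; rewrite (ltW e0) far.
Qed.

(** The open mapping theorem for polynomials, with the explicit radius supplied by [root_near]. *)
Lemma open_image_horner (U : set C) : open U -> open ((horner F : C -> C) @` U).
Proof.
move=> /open_cmod oU; apply/open_cmod => _ [z Uz <-].
have [e e0 eU] := oU z Uz.
exists (cmod (lead_coef F) * e ^+ D); first by rewrite mulr_gt0 ?cmod_gt0 // exprn_gt0.
move=> w hw; have [x xf xe] : exists2 x, x \in fibre F w & cmod (z - x) < e.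
  by apply: (@root_near w F.[z]) => //; rewrite cmod_distC.
exists x; first by apply: eU; rewrite cmod_distC.
by apply/eqP; rewrite -mem_fibre.
Qed.

Lemma fibre_bounded (w0 : R[i]) : exists B : R, forall w z,
  cmod (w - w0) < cmod (lead_coef F) -> z \in fibre F w -> cmod z <= B.
Proof.
exists (1 + \sum_(x <- fibre F w0) cmod x) => w z hw.
rewrite mem_fibre // => /eqP Fz.
have [|x xf xz] := @root_near w0 w z 1 ltr01 Fz; first by rewrite expr1n mulr1.
have -> : z = (z - x) + x by rewrite subrK.
apply: le_trans (cmodD _ _) _; rewrite lerD ?(ltW xz) //.
rewrite (big_rem x) //= lerDl; apply: sumr_ge0 => y _; exact: cmod_ge0.
Qed.

Let root_at i w := nth 0 (fibre F w) i.

Let fibre_mkseq w : fibre F w = [seq root_at i w | i <- iota 0 D].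
Proof. by rewrite -(size_fibre F_gt1 w); symmetry; exact: mkseq_nth. Qed.

Lemma eq_poly_horner (K : numFieldType) (p q : {poly K}) : (forall x, p.[x] = q.[x]) -> p = q.
Proof.
move=> pq; apply/eqP; rewrite -subr_eq0; apply/eqP.
apply: (@roots_geq_poly_eq0 _ _ [seq i%:R | i <- iota 0 (size (p - q))]).
- by apply/allP => x _; rewrite rootE hornerD hornerN pq subrr.
- by rewrite map_inj_uniq ?iota_uniq // => i j /eqP; rewrite eqr_nat => /eqP.
- by rewrite size_map size_iota.
Qed.

(* Continuity of the roots, with multiplicities: the roots of [F - w] being bounded,
   they converge along an ultrafilter, and the limit of the factorization of
   [F - w] is a factorization of [F - w0]. *)
Lemma fibre_ultra (w0 : C) (G : set_system C) : UltraFilter G -> G --> w0 ->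
  exists p : nat -> C, (forall i, (i < D)%N -> (root_at i : C -> C) @ G --> p i) /\
    perm_eq (fibre F w0) [seq p i | i <- iota 0 D].
Proof.
move=> UG Gw0; have PG : ProperFilter G := @ultra_proper _ _ UG.
have [B HB] := fibre_bounded w0.
have nearG : G [set w : C | cmod ((w : R[i]) - w0) < cmod (lead_coef F)].
  by apply: Gw0; apply/nbhs_cmod; exists (cmod (lead_coef F)); rewrite ?cmod_gt0.
pose K := [set z : C | 0 - B <= complex.Re z <= 0 + B /\ 0 - B <= complex.Im z <= 0 + B].
have root_lim i : (i < D)%N -> exists p : C, (root_at i : C -> C) @ G --> p.
  move=> iD; have GK : G ((root_at i : C -> C) @^-1` K).
    apply: filterS nearG => w /= hw.
    have zB : cmod (root_at i w) <= B.
      by apply: HB hw _; apply: mem_nth; rewrite size_fibre.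
    have := le_trans (Re_le_cmod _) zB; have := le_trans (Im_le_cmod _) zB.
    by rewrite !ler_norml /K /= sub0r add0r.
  have [p [_ clp]] := @compact_square R 0 0 B ((root_at i : C -> C) @ G) _ GK.
  (* Along an ultrafilter a cluster point is a limit: if the preimage of V were not in G, its
     complement would be, and then p could not be a cluster point. *)
  exists p => V Vp; have [//|GV] := in_ultra_setVsetC ((root_at i : C -> C) @^-1` V) UG.
  by have [x [nVx Vx]] := clp (~` V) V GV Vp.
have /choice [p Hp] : forall i, exists p : C, (i < D)%N -> (root_at i : C -> C) @ G --> p.
  move=> i; have [iD|iD] := ltnP i D; first by have [p hp] := root_lim i iD; exists p.
  by exists w0.
exists p; split => //; apply: prod_XsubC_eq; apply: eq_poly_horner => z.
have HC : hausdorff_space C by exact: norm_hausdorff.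
have PH (s : seq R[i]) : (\prod_(x <- s) ('X - x%:P)).[z] = \prod_(x <- s) (z - x).
  by rewrite horner_prod; apply: eq_bigr => x _; rewrite hornerXsubC.
rewrite !PH; apply: (mulfI lead_neq0).
rewrite -(horner_fibre F_gt1 w0 z) big_map.
have FG : Filter G := @filter_filter _ _ PG.
have cst_z (c : C) : (fun=> c) @ G --> c by exact: (@cvg_cst C c C G FG).
have l1 : (fun w : C => (F.[z] - w : C)) @ G --> (F.[z] - w0 : C).
  exact: (cvgB (cst_z _) Gw0).
have l2 : (fun w : C => (F.[z] - w : C)) @ G -->
    ((lead_coef F : C) * \prod_(i <- iota 0 D) ((z : C) - p i) : C).
  have -> : (fun w : C => (F.[z] - w : C)) =
      (fun w : C => (lead_coef F : C) * \prod_(i <- iota 0 D) ((z : C) - (root_at i w : C))).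
    by apply/funext => w; rewrite (horner_fibre F_gt1) {1}fibre_mkseq big_map.
  apply: (cvgM_complex (FG := FG) (cst_z _)).
  rewrite big_seq; under eq_fun do rewrite big_seq.
  apply: (@cvg_big C nat *%R 1 (fun i => i \in iota 0 D) (@mul_continuous _) _ _ _ _ _ FG).
  by move=> i; rewrite mem_iota add0n => iD; exact: (cvgB (cst_z _) (Hp i iD)).
exact: (cvg_unique HC l1 l2).
Qed.

(** Lower semicontinuity of the number of roots in [U]. The enumeration [root_at] has no continuity
    of its own, but it converges along any ultrafilter tending to w0; a failure at w0 would yield
    such an ultrafilter living where the count is too small. *)
Lemma open_count_fibre (U : set C) m : open U ->
  open [set w : C | (m <= count (fun z => z \in U) (fibre F w))%N].
Proof.
move=> oU; rewrite openE => w0 /= m0; apply: contrapT => nS.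
set S := [set w : C | _] in nS.
have PW : ProperFilter (within (~` S) (nbhs w0)).
  apply: Build_ProperFilter_ex => A WA; apply: contrapT => nA; apply: nS.
  apply: (@filterS _ _ (@nbhs_filter C w0) _ _ _ WA) => w hw; apply: contrapT => nSw.
  by apply: nA; exists w; exact: hw.
have [G [UG WG]] := ultraFilterLemma PW.
have PG : ProperFilter G := @ultra_proper _ _ UG.
have Gw0 : G --> w0 by move=> V Vw; apply: WG; apply: filterS Vw => w Vw _.
have GS : G (~` S) by apply: WG; rewrite /within /=; apply: filterE.
have [p [cp pp]] := fibre_ultra UG Gw0.
have near_i (i : 'I_D) : \forall w \near G, p i \in U -> (root_at i w : C) \in U.
  have [pU|npU] := boolP (p i \in U); last by apply: filterE.
  have Up : nbhs (p i) U by apply: open_nbhs_nbhs; split => //; exact: set_mem.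
  have h : G ((root_at i : C -> C) @^-1` U) := cp i (ltn_ord i) U Up.
  by apply: (@filterS _ _ (@filter_filter _ _ PG) _ _ _ h) => w Uw _; exact: mem_set.
have [w [nSw]] := filter_ex (filterI GS (filter_forall (@filter_filter _ _ PG) near_i)).
move=> Hw; apply: nSw; rewrite /S /=; apply: leq_trans m0 _.
rewrite (permP pp) fibre_mkseq !count_map.
rewrite -(@eq_in_count _ (fun i => (p i \in U) && (i \in iota 0 D))); last first.
  by move=> i /= ->; rewrite andbT.
apply: sub_count => i /=; rewrite mem_iota add0n => /andP[pU iD].
by rewrite (Hw (Ordinal iD)).
Qed.

End RootContinuity.

(** * Averaging a measure over the fibres of a polynomial *)

Section FibreMeasure.
Variables (R : realType) (F : {poly R[i]}).
Hypothesis F_gt1 : (1 < size F)%N.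
Local Notation D := (size F).-1.
Local Notation T := (borelC R).

Let root_at i (w : T) : T := nth 0 (fibre F w) i.

Definition fibre_measure (w : T) : set T -> \bar R :=
  mscale (D%:R^-1)%:nng (msum (fun i => \d_(root_at i w)) D).

HB.instance Definition _ w := Measure.on (fibre_measure w).

Let D_gt0 : (0 < D)%N. Proof. by case: (size F) F_gt1 => [|[|n]]. Qed.

Let fibre_measureT w : fibre_measure w setT = 1%E.
Proof.
rewrite /fibre_measure /mscale /= /msum (eq_bigr (fun=> 1%E)); last first.
  by move=> i _; exact: diracT.
rewrite sumEFin sumr_const card_ord -EFinM.
by rewrite mulVf // pnatr_eq0 -lt0n.
Qed.

HB.instance Definition _ w :=
  Measure_isProbability.Build _ _ _ (fibre_measure w) (fibre_measureT w).

Definition fibre_prob (w : T) : probability T R := fibre_measure w.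

Lemma integral_fibre_prob w (phi : T -> \bar R) : measurable_fun setT phi ->
  (forall x, 0 <= phi x)%E ->
  (\int[fibre_prob w]_x phi x = (D%:R^-1)%:E * \sum_(x <- fibre F w) phi x)%E.
Proof.
move=> mphi phi0; rewrite ge0_integral_mscale //=; congr (_ * _)%E.
rewrite ge0_integral_measure_sum // (big_nth 0) size_fibre // big_mkord.
by apply: eq_bigr => i _; rewrite integral_dirac // diracT mul1e.
Qed.

Lemma fibre_probE w A : (fibre_prob w A =
  (D%:R^-1)%:E * \sum_(x <- fibre F w) (\1_A (x : T))%:E)%E.
Proof.
rewrite [LHS]/(fibre_measure w A) /mscale /=; congr (_ * _)%E.
by rewrite (big_nth 0) size_fibre // big_mkord.
Qed.

(** Dynkin's theorem reduces the claim to open sets, which are stable under intersection. *)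
Lemma measurable_fibre_prob A : measurable A ->
  measurable_fun setT (fun w => fibre_prob w A).
Proof.
move=> mA.
apply: (@dynkin_induction _ T (@open R[i]^o)
  (fun A => measurable_fun setT (fun w => fibre_prob w A))) mA => //.
- by move=> U V; exact: openI.
- by under eq_fun do rewrite probability_setT; exact: measurable_cst.
- move=> U oU.
  have -> : (fun w => fibre_prob w U) = (fun w => (D%:R^-1 *
      \sum_(m < D) \1_[set w : T | (m < count (fun z => z \in U) (fibre F w))%N] w)%:E).
    apply/funext => w; rewrite fibre_probE EFinM; congr (_ * _)%E.
    rewrite sumEFin; congr (_%:E).
    have -> s : \sum_(x <- s) \1_U (x : T) = (count (fun z => z \in U) s)%:R :> R.
      elim: s => [|x s IH]; first by rewrite big_nil.
      by rewrite big_cons IH indicE /= natrD.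
    have cD : (count (fun z => z \in U) (fibre F w) <= D)%N.
      by rewrite -(size_fibre F_gt1 w) count_size.
    move: cD; set c := count _ _ => cD.
    (* Layer-cake decomposition of the count: each layer is the indicator of a set that is open by
       [open_count_fibre]. *)
    have -> : (c = \sum_(m < D) (m < c))%N.
      rewrite -(big_mkord xpredT (fun m => (m < c) : nat)) (@big_cat_nat _ _ _ c) //=.
      rewrite [X in (_ + X)%N]big_nat_cond [X in (_ + X)%N]big1 ?addn0; last first.
        by move=> i /andP[/andP[ci _] _]; rewrite ltnNge ci.
      rewrite (eq_big_nat _ _ (F2 := fun=> 1%N)); last by move=> i /andP[_ ->].
      by rewrite sum_nat_const_nat subn0 muln1.
    rewrite natr_sum; apply: eq_bigr => m _; rewrite indicE; congr (nat_of_bool _)%:R.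
    by apply/idP/idP => [h|/set_mem //]; exact/mem_set.
  apply/measurable_EFinP/measurable_funM => //; apply: measurable_sum => m.
  apply: measurable_indic; apply: sub_sigma_algebra; exact: open_count_fibre.
- move=> S mS IH.
  under eq_fun do rewrite probability_setC //.
  by apply: emeasurable_funB => //; exact: measurable_cst.
- move=> G mG tG IH.
  have -> : (fun w => fibre_prob w (\bigcup_k G k)) =
      (fun w => \sum_(0 <= k <oo) fibre_prob w (G k))%E.
    by apply/funext => w; rewrite measure_bigcup //; apply: eq_eseriesl => k; rewrite in_setT.
  by apply: ge0_emeasurable_sum.
Qed.

End FibreMeasure.

Section Pullback.
Variables (R : realType) (F : {poly R[i]}).
Hypothesis F_gt1 : (1 < size F)%N.
Local Notation D := (size F).-1.
Local Notation T := (borelC R).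
Variable mu : probability T R.

Let fibre_giry (z : T) : giry T R := fibre_prob F_gt1 F.[z].

Let measurable_fibre_giry : measurable_fun setT fibre_giry.
Proof.
apply: measurable_giry_codensity => // B mB.
exact: (measurableT_comp (measurable_fibre_prob F_gt1 mB) (measurable_horner F)).
Qed.

(** The measure sigma, as the [mu]-mixture of the uniform probabilities on the fibres through the
    points z. *)
Definition pullback_measure : set T -> \bar R := giry_bind mu measurable_fibre_giry.

HB.instance Definition _ := Measure.on pullback_measure.

Lemma integral_pullback_measure (phi : T -> \bar R) : measurable_fun setT phi ->
  (forall x, 0 <= phi x)%E ->
  (\int[pullback_measure]_x phi x =
   \int[mu]_z ((D%:R^-1)%:E * \sum_(x <- fibre F F.[z]) phi x))%E.
Proof.
move=> mphi phi0.
have := giry_int_bind mu measurable_fibre_giry mphi phi0.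
rewrite /giry_int => E; rewrite [LHS]E; apply: eq_integral => z _.
exact: integral_fibre_prob.
Qed.

Let pullbackT : pullback_measure setT = 1%E.
Proof.
have := integral_pullback_measure (measurable_cst (1%E : \bar R)) (fun=> lee01).
rewrite integral_cst // mul1e => ->.
rewrite (eq_integral (fun=> 1%E)); first by rewrite integral_cst // mul1e; exact: probability_setT.
move=> z _; rewrite -(@integral_fibre_prob _ _ F_gt1 F.[z] (fun=> 1%E)) //.
by rewrite integral_cst // mul1e; exact: probability_setT.
Qed.

HB.instance Definition _ :=
  Measure_isProbability.Build _ _ _ pullback_measure pullbackT.

Definition pullback : probability T R := pullback_measure.

Lemma integral_pullback (phi : T -> \bar R) : measurable_fun setT phi ->
  (forall x, 0 <= phi x)%E ->
  (\int[pullback]_x phi x =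
   \int[mu]_z ((D%:R^-1)%:E * \sum_(x <- fibre F F.[z]) phi x))%E.
Proof. exact: integral_pullback_measure. Qed.

Lemma measurable_fibre_sum (phi : T -> \bar R) : measurable_fun setT phi ->
  (forall x, 0 <= phi x)%E ->
  measurable_fun setT (fun z : T => (D%:R^-1)%:E * \sum_(x <- fibre F F.[z]) phi x)%E.
Proof.
move=> mphi phi0.
under eq_fun => z do rewrite -(integral_fibre_prob F_gt1) //.
have mf U : measurable U -> measurable_fun setT (fun z : T => fibre_prob F_gt1 F.[z] U).
  move=> mU; exact: (measurableT_comp (measurable_fibre_prob F_gt1 mU) (measurable_horner F)).
exact: (@measurable_fun_integral_kernel _ _ T T R (fun z => fibre_prob F_gt1 F.[z]) mf phi phi0 mphi).
Qed.

End Pullback.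

(** * Integration against a probability carried by a set *)

Section FullMeasure.
Context d (T : measurableType d) (R : realType).
Variables (P : probability T R) (J : set T).
Hypotheses (mJ : measurable J) (PJ : P J = 1%E).
Local Open Scope ereal_scope.

Lemma ae_full : {ae P, forall x, J x}.
Proof.
exists (~` J); split; first exact: measurableC.
  by rewrite probability_setC // [X in _ - X]PJ subee.
by move=> x /=.
Qed.

Lemma eq_integral_full (f g : T -> \bar R) : measurable_fun setT f ->
  measurable_fun setT g -> (forall x, J x -> f x = g x) ->
  \int[P]_x f x = \int[P]_x g x.
Proof.
move=> mf mg fg; apply: ae_eq_integral => //.
by apply: filterS ae_full => x Jx _; exact: fg.
Qed.

Lemma le_integral_full (f g : T -> \bar R) : measurable_fun setT f ->
  measurable_fun setT g -> (forall x, 0 <= f x) -> (forall x, 0 <= g x) ->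
  (forall x, J x -> f x <= g x) ->
  \int[P]_x f x <= \int[P]_x g x.
Proof.
move=> mf mg f0 g0 fg; apply: ae_ge0_le_integral => //.
by apply: filterS ae_full => x Jx _; exact: fg.
Qed.

End FullMeasure.

Section ShiftedIntegral.
Context d (T : measurableType d) (R : realType).
Variable P : probability T R.
Local Open Scope ereal_scope.

Lemma integral_prob_cst (c : R) : \int[P]_x c%:E = c%:E.
Proof. by rewrite integral_cst // [X in _ * X]probability_setT mule1. Qed.

(* The integral of [g + c] is not covered by the additivity of the integral when
   [g] is not integrable and [c] is negative. *)
Lemma integral_add_cst (g : T -> \bar R) (c : R) : measurable_fun setT g ->
  (forall x, 0 <= g x) -> \int[P]_x (g x + c%:E) = \int[P]_x g x + c%:E.
Proof.
move=> mg g0; have ic : P.-integrable setT (cst c%:E).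
  exact: (bmf_integrable _ (bmf_cst T c)).
have [goo|] := boolP (\int[P]_x g x < +oo).
  have ig : P.-integrable setT g.
    apply/integrableP; split => //.
    by under eq_integral => x _ do rewrite gee0_abs //.
  by rewrite integralD // integral_prob_cst.
rewrite -leNgt leye_eq => /eqP goo; rewrite goo addye //.
have mgc : measurable_fun setT (fun x => g x + c%:E).
  by apply: emeasurable_funD => //; exact: measurable_cst.
set f := fun x => g x + c%:E in mgc *.
(* When g has infinite integral, the negative part of g + c stays below |c| while its positive part
   is at least g - |c|, so the integral of g + c is infinite too. *)
have negle x : f^\- x <= `|c|%:E.
  rewrite funenegE ge_max lee_fin normr_ge0 andbT /f oppeD; last first.
    by rewrite fin_num_adde_defl.
  rewrite -[leRHS]add0e -EFinN leeD ?oppe_le0 // lee_fin.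
  by rewrite (le_trans (ler_norm _)) // normrN.
have posge x : g x <= f^\+ x + `|c|%:E.
  rewrite funeposE; apply: (@le_trans _ _ (f x + `|c|%:E)); last first.
    by rewrite leeD2r // le_max lexx.
  rewrite /f -addeA -EFinD leeDl // lee_fin.
  by have := ler_norm (- c)%R; rewrite normrN; lra.
have intneg : \int[P]_x f^\- x < +oo.
  apply: (@le_lt_trans _ _ `|c|%:E); last by rewrite ltry.
  rewrite -(integral_prob_cst `|c|); apply: ge0_le_integral => //.
  exact: measurable_funeneg.
rewrite integralE.
suff -> : \int[P]_x f^\+ x = +oo.
  by rewrite addye // eqe_oppLR; apply/negP => /eqP e; move: intneg; rewrite e.
apply/eqP; rewrite -leye_eq -(@leeD2rE _ `|c|%:E) // addye //.
rewrite -goo -(integral_prob_cst `|c|) -ge0_integralD //.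
  apply: ge0_le_integral => //.
  by apply: emeasurable_funD; [exact: measurable_funepos | exact: measurable_cst].
exact: measurable_funepos.
Qed.

End ShiftedIntegral.

(** * Sums of logarithms and products over a finite family *)

Section FibreSums.
Variable R : realType.

Lemma prod_convex_le (I : eqType) (s : seq I) (u : I -> R) (e : R) :
  0 <= e <= 1 -> (forall i, i \in s -> 0 <= u i <= 1) ->
  \prod_(i <- s) (e + (1 - e) * u i) <= e + (1 - e) * \prod_(i <- s) u i.
Proof.
move=> /andP[e0 e1]; elim: s => [|i s IH] us; first by rewrite !big_nil; lra.
rewrite !big_cons.
have /andP[u0 u1] : 0 <= u i <= 1 by apply: us; rewrite inE eqxx.
have us' j : j \in s -> 0 <= u j <= 1 by move=> js; apply: us; rewrite inE js orbT.
have P01 : 0 <= \prod_(j <- s) u j <= 1.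
  rewrite big_seq; apply/andP; split.
    by apply: prodr_ge0 => j /us' /andP[].
  by apply: prodr_ile1 => j /us'.
have {}IH := IH us'; set P := \prod_(j <- s) u j in IH P01 *.
case/andP: P01 => P0 P1.
have w0 : 0 <= e + (1 - e) * u i by nra.
apply: le_trans (ler_wpM2l w0 IH) _.
(* This is exactly the gap between e + (1 - e) u P and the product of e + (1 - e) u and e + (1 - e)
   P. *)
have : 0 <= e * (1 - e) * ((1 - u i) * (1 - P)).
  by apply: mulr_ge0; apply: mulr_ge0; lra.
by nra.
Qed.

Lemma sum_ln_prod (I : eqType) (s : seq I) (v : I -> R) :
  (forall i, i \in s -> 0 < v i) ->
  \sum_(i <- s) ln (v i) = ln (\prod_(i <- s) v i).
Proof.
elim: s => [|i s IH] vs; first by rewrite !big_nil ln1.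
have vi : 0 < v i by apply: vs; rewrite inE eqxx.
have vs' j : j \in s -> 0 < v j by move=> js; apply: vs; rewrite inE js orbT.
rewrite !big_cons lnM ?posrE // ?IH // big_seq; exact: prodr_gt0.
Qed.

(* As [(e + (1 - e) x) (e + (1 - e) y) <= e + (1 - e) x y], a sum of regularized
   logarithms is controlled by the product of the arguments, up to the factor
   [size s]; this is how families with the same product are compared. *)
Lemma regularized_sum_le (I : eqType) (s : seq I) (u u' H H' : I -> R) (e : R) :
  0 < e <= 1 ->
  (forall i, i \in s -> 0 <= u i <= 1) -> (forall i, i \in s -> 0 <= u' i <= 1) ->
  \prod_(i <- s) u i = \prod_(i <- s) u' i ->
  (forall i, i \in s -> - ln (e + (1 - e) * u i) <= H i) ->
  (forall i, i \in s -> H' i <= - ln (e + (1 - e) * u' i) + ln 4) ->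
  \sum_(i <- s) H' i <= (size s)%:R * \sum_(i <- s) H i + (size s)%:R * ln 4.
Proof.
move=> /andP[e0 e1] us us' uu HH HH'.
have pos (v : R) : 0 <= v -> 0 < e + (1 - e) * v.
  by move=> v0; rewrite ltr_pwDl // mulr_ge0 // subr_ge0.
set U := \prod_(i <- s) u i in uu *.
have U0 : 0 <= U by rewrite /U big_seq prodr_ge0 // => i /us /andP[].
have lb : - ln (e + (1 - e) * U) <= \sum_(i <- s) H i.
  apply: (@le_trans _ _ (\sum_(i <- s) - ln (e + (1 - e) * u i))); last first.
    by rewrite big_seq [leRHS]big_seq; apply: ler_sum.
  have pi i : i \in s -> 0 < e + (1 - e) * u i by move=> /us /andP[? _]; exact: pos.
  rewrite sumrN lerN2 (sum_ln_prod pi) ler_ln ?posrE ?pos //.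
    by apply: prod_convex_le => //; rewrite (ltW e0).
  by rewrite big_seq prodr_gt0.
(* All factors being at most 1, the product [U] is below each of them; bounding every single term by
   the whole product is what costs the factor [size s]. *)
have ub i : i \in s -> H' i <= - ln (e + (1 - e) * U) + ln 4.
  move=> si; apply: le_trans (HH' i si) _; rewrite lerD2r lerN2.
  have /andP[u0 u1] := us' i si.
  rewrite ler_ln ?posrE ?pos // lerD2l ler_wpM2l ?subr_ge0 //.
  rewrite uu (big_rem i) //= ler_piMr //.
  rewrite big_seq; apply: prodr_ile1 => j js; apply: us'; exact: mem_rem js.
apply: (@le_trans _ _ (\sum_(i <- s) (- ln (e + (1 - e) * U) + ln 4))).
  by rewrite big_seq [leRHS]big_seq; apply: ler_sum.
rewrite big_const_seq count_predT iter_addr_0 -[leLHS]mulr_natl mulrDr lerD2r.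
by rewrite ler_wpM2l.
Qed.

(** Zero factors are allowed: both sides are then +oo, and no indeterminate sum arises since - lne
    of a real number is never -oo. *)
Lemma sum_lne_prod (I : eqType) (s : seq I) (v : I -> R) :
  (forall i, i \in s -> 0 <= v i) ->
  (\sum_(i <- s) - lne (v i)%:E = - lne (\prod_(i <- s) v i)%:E)%E.
Proof.
elim: s => [|i s IH] vs; first by rewrite !big_nil lne1 oppe0.
have vi : 0 <= v i by apply: vs; rewrite inE eqxx.
have vs' j : j \in s -> 0 <= v j by move=> js; apply: vs; rewrite inE js orbT.
rewrite !big_cons IH //; set P := \prod_(j <- s) v j.
have P0 : 0 <= P by rewrite /P big_seq prodr_ge0.
have ninf x : 0 <= x -> (- lne x%:E != -oo)%E.
  by move=> x0; rewrite eqe_oppLR /lne; case: ifP.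
move: vi; rewrite le_eqVlt => /predU1P[<-|vi].
  by rewrite mul0r (le0_lneNy (lexx 0%E)) addye // ninf.
move: P0; rewrite le_eqVlt => /predU1P[<-|P0].
  by rewrite mulr0 (le0_lneNy (lexx 0%E)) addey // ninf // ltW.
by rewrite !lne_EFin ?mulr_gt0 // lnM ?posrE // -!EFinN -EFinD opprD.
Qed.

Lemma measurable_lne : measurable_fun setT (fun r : R => lne r%:E).
Proof.
rewrite /lne; apply: measurable_fun_ifT.
- exact: measurable_fun_ler.
- exact: measurable_cst.
- by apply/measurable_EFinP.
Qed.

End FibreSums.

Section Scaling.
Variables (R : realType) (rho : R).
Hypothesis rho_gt0 : 0 < rho.
Local Notation T := (borelC R).

(* Points far from the origin are sent to 0: they do not matter, and the kernels
   below are then bounded everywhere. *)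
Definition scale (z : T) : R[i] :=
  ((\1_[set z : T | cmod z <= rho / 2] z / rho)%:C * (z : R[i]))%R.

Lemma scale_small (z : T) : cmod z <= rho / 2 -> scale z = (rho^-1)%:C * (z : R[i]).
Proof. by move=> zr; rewrite /scale indicE mem_set //= mul1r. Qed.

Lemma scale_half (z : T) : cmod (scale z) <= 2^-1.
Proof.
have [zr|zr] := leP (cmod z) (rho / 2).
  rewrite scale_small // cmodM cmod_real ger0_norm ?invr_ge0 ?(ltW rho_gt0) //.
  by rewrite ler_pdivrMl // mulrC.
by rewrite /scale indicE memNset /= ?mul0r ?cmod0 ?invr_ge0 // leNgt zr.
Qed.

Lemma cbmf_scale : cbmf scale.
Proof.
have mB : measurable [set z : T | cmod z <= rho / 2].
  have := @measurable_cmod R measurableT `]-oo, rho / 2]%classic (measurable_itv _).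
  by rewrite setTI; congr measurable; apply/seteqP; split => z /=; rewrite in_itv.
have mi : measurable_fun setT (fun z : T => \1_[set z : T | cmod z <= rho / 2] z / rho).
  by apply: measurable_funM => //; exact: measurable_indic.
split; split.
- rewrite /scale; under eq_fun do rewrite Re_mul /= mul0r subr0.
  by apply: measurable_funM => //; exact: measurable_Re.
- by exists 2^-1 => z; exact: le_trans (Re_le_cmod _) (scale_half z).
- rewrite /scale; under eq_fun do rewrite Im_mul /= mul0r addr0.
  by apply: measurable_funM => //; exact: measurable_Im.
- by exists 2^-1 => z; exact: le_trans (Im_le_cmod _) (scale_half z).
Qed.

Lemma cmod_scaleB (z w : T) : cmod z <= rho / 2 -> cmod w <= rho / 2 ->
  cmod (scale z - scale w) = cmod ((z : R[i]) - (w : R[i])) / rho.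
Proof.
move=> zr wr; rewrite !scale_small // -mulrBr cmodM cmod_real mulrC.
by rewrite ger0_norm // invr_ge0 ltW.
Qed.

Lemma cmod_scaleB_le1 (z w : T) : cmod (scale z - scale w) <= 1.
Proof.
have := cmodD (scale z) (- scale w); rewrite cmodN.
by have := scale_half z; have := scale_half w; lra.
Qed.

End Scaling.

(** * Energies *)

Section RegularizedEnergy.
Variables (R : realType) (rho : R).
Hypothesis rho_gt0 : 0 < rho.
Local Notation T := (borelC R).
Local Notation a := (scale rho).

(** Starting at 1/2 ensures 1/2 <= 1 - [eps n], on which the comparison with convex combinations in
    [reg_mean_le] depends. *)
Let eps n : R := n.+2%:R^-1.

Let eps_bounds n : 0 < eps n <= 2^-1.
Proof. by rewrite /eps invr_gt0 ltr0n lef_pV2 ?posrE ?ltr0n // ler_nat. Qed.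

Let eps_bounds1 n : 0 < eps n <= 1.
Proof. by have /andP[-> h] := eps_bounds n; lra. Qed.

(** The argument of the logarithm is at most 2, so adding [ln 2] makes the kernel nonnegative; it
    increases with n to [lim_kernel]. *)
Definition reg_kernel n (z w : T) : R := log_kernel a (eps n) z w + ln 2.

Definition lim_kernel (z w : T) : \bar R :=
  (2%:E * - lne (cmod (a z - a w))%:E + (ln 2)%:E)%E.

Let a_half := scale_half rho_gt0.
Let a_bmf := cbmf_scale rho_gt0.

Lemma reg_kernel_bkernel n : bkernel (reg_kernel n).
Proof.
exact: bmfD (log_kernel_bkernel a_bmf a_half (eps_bounds1 n)) (bmf_cst _ _).
Qed.

Let arg n z w := cmod (a z - a w) ^+ 2 +
        eps n * ((1 - cmod (a z) ^+ 2) * (1 - cmod (a w) ^+ 2)).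

Let arg_bounds n z w : 0 < arg n z w <= 2.
Proof.
have /andP[lo ->] := log_kernel_arg a_half z w (eps_bounds1 n).
rewrite andbT; apply: lt_le_trans lo; apply: mulr_gt0; first by case/andP: (eps_bounds n).
by apply: exprn_gt0; lra.
Qed.

Lemma reg_kernel_ge0 n z w : 0 <= reg_kernel n z w.
Proof.
have /andP[a0 a2] := arg_bounds n z w.
by rewrite /reg_kernel /log_kernel addrC subr_ge0 ler_ln ?posrE.
Qed.

Let wt_bounds z w : (3 / 4) ^+ 2 <= (1 - cmod (a z) ^+ 2) * (1 - cmod (a w) ^+ 2) <= 1.
Proof.
have /andP[z0 z1] := weight_bounds a_half z; have /andP[w0 w1] := weight_bounds a_half w.
move: z0 z1 w0 w1; set A := 1 - _; set B := 1 - _ => z0 z1 w0 w1.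
by apply/andP; split; rewrite ?expr2; nra.
Qed.

Lemma reg_kernel_nd m n z w : (m <= n)%N -> reg_kernel m z w <= reg_kernel n z w.
Proof.
move=> mn; have /andP[m0 _] := arg_bounds m z w; have /andP[n0 _] := arg_bounds n z w.
have /andP[c0 _] := wt_bounds z w.
rewrite lerD2r lerN2 ler_ln ?posrE // lerD2l ler_wpM2r //.
  by apply: le_trans c0; apply: exprn_ge0; lra.
by rewrite /eps lef_pV2 ?posrE ?ltr0n // ler_nat.
Qed.

Lemma lim_kernel_ge0 z w : (0 <= lim_kernel z w)%E.
Proof.
rewrite /lim_kernel adde_ge0 //; last by rewrite lee_fin ln_ge0 ?ler1n.
rewrite mule_ge0 // ?lee_fin // oppe_ge0 lne_le0 lee_fin.
exact: cmod_scaleB_le1.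
Qed.

Lemma measurable_dist : measurable_fun setT (fun p : T * T => cmod (a p.1 - a p.2)).
Proof.
have [[ar _] [ai _]] := a_bmf.
have -> : (fun p : T * T => cmod (a p.1 - a p.2)) =
  (fun p : T * T => Num.sqrt ((complex.Re (a p.1) - complex.Re (a p.2)) ^+ 2 +
     (complex.Im (a p.1) - complex.Im (a p.2)) ^+ 2)).
  by apply/funext => p; rewrite -Re_sub -Im_sub -sqr_cmod sqrtr_sqr ger0_norm ?cmod_ge0.
apply: (measurableT_comp (f := @Num.sqrt R)).
  by apply: continuous_measurable_fun; exact: sqrt_continuous.
have mrr (f : T -> R) : measurable_fun setT f ->
    measurable_fun setT (fun p : T * T => f p.1) /\
    measurable_fun setT (fun p : T * T => f p.2).
  by move=> mf; split; apply: measurableT_comp.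
have [ar1 ar2] := mrr _ ar; have [ai1 ai2] := mrr _ ai.
by apply: measurable_funD; apply: measurable_funX; apply: measurable_funB.
Qed.

Lemma measurable_lim_kernel :
  measurable_fun setT (fun p : T * T => lim_kernel p.1 p.2).
Proof.
apply: emeasurable_funD; last exact: measurable_cst.
apply: measurable_funeM; apply: measurableT_comp => //.
exact: (measurableT_comp (@measurable_lne R) measurable_dist).
Qed.

Lemma reg_kernel_cvg z w : (reg_kernel n z w)%:E @[n --> \oo] --> lim_kernel z w.
Proof.
have eps0 : eps n @[n --> \oo] --> (0 : R).
  have := @cvg_harmonic R; rewrite -(cvg_shiftS (@harmonic R)); exact.
set r := cmod (a z - a w); set c := (1 - cmod (a z) ^+ 2) * (1 - cmod (a w) ^+ 2).
have /andP[c0 c1] := wt_bounds z w; rewrite -/c in c0 c1.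
have cpos : 0 < c by apply: lt_le_trans c0; apply: exprn_gt0; lra.
have r0 : 0 <= r by exact: cmod_ge0.
move: r0; rewrite le_eqVlt => /predU1P[r0|r0]; last first.
  have -> : lim_kernel z w = (- ln (r ^+ 2 + 0 * c) + ln 2)%:E.
    rewrite /lim_kernel -/r lne_EFin // mul0r addr0 lnXn // -EFinN -EFinM -EFinD.
    by congr (_ + _)%:E; rewrite mulrN mulr_natl.
  apply/cvg_EFin; first exact: nearW.
  apply: cvgD; last exact: cvg_cst.
  apply: cvgN; have h1 : r ^+ 2 + eps n * c @[n --> \oo] --> (r ^+ 2 + 0 * c).
    by apply: cvgD; [exact: cvg_cst | apply: cvgM => //; exact: cvg_cst].
  have h2 : {for r ^+ 2 + 0 * c, continuous (@ln R)}.
    by apply: continuous_ln; rewrite mul0r addr0 exprn_gt0.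
  exact: (cvg_comp _ _ h1 h2).
(* When the scaled points coincide only [eps n * c] is left in the logarithm, with [c] at most 1,
   and - ln (eps n) = ln (n + 2) is unbounded. *)
have -> : lim_kernel z w = +oo%E.
  rewrite /lim_kernel -/r -r0 (le0_lneNy (lexx 0%E)) /=.
  by rewrite gt0_muley ?lte_fin // addye.
apply/cvgeyPge => A; near=> n.
rewrite lee_fin /reg_kernel /log_kernel -/r -r0 expr0n /= add0r -/c.
have en0 : 0 < eps n by case/andP: (eps_bounds n).
apply: (@le_trans _ _ (- ln (eps n))); last first.
  have ec0 : 0 < eps n * c by exact: mulr_gt0.
  rewrite -[leLHS]addr0 lerD ?ln_ge0 ?ler1n // lerN2 ler_ln ?posrE //.
  by rewrite ler_piMr // ltW.
have -> : - ln (eps n) = ln n.+2%:R.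
  by rewrite /eps (@lnV R n.+2%:R) ?posrE ?ltr0n // opprK.
rewrite -(expRK A) ler_ln ?posrE ?expR_gt0 ?ltr0n //.
apply: (@le_trans _ _ n%:R); last by rewrite ler_nat; lia.
near: n; exact: nbhs_infty_ger.
Unshelve. all: by end_near. Qed.

Section Mutual.
Variables (P Q : probability T R).

Definition reg_energy n : R := mutual P Q (reg_kernel n).

Let mH n : measurable_fun setT (fun p : T * T => (reg_kernel n p.1 p.2)%:E).
Proof. by apply/measurable_EFinP; case: (reg_kernel_bkernel n). Qed.

Let H0 n (p : T * T) : (0 <= (reg_kernel n p.1 p.2)%:E)%E.
Proof. by rewrite lee_fin reg_kernel_ge0. Qed.

Let L0 (p : T * T) : (0 <= lim_kernel p.1 p.2)%E.
Proof. exact: lim_kernel_ge0. Qed.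

Lemma reg_energyE n :
  (\int[P]_z \int[Q]_w (reg_kernel n z w)%:E = (reg_energy n)%:E)%E.
Proof.
have bH := reg_kernel_bkernel n.
rewrite /reg_energy /mutual /Rintegral fineK; last first.
  exact: integrable_fin_num (bmf_integrable _ bH).
by rewrite (fubini_tonelli1 (fun p : T * T => (reg_kernel n p.1 p.2)%:E)).
Qed.

Lemma reg_energy_le n :
  ((reg_energy n)%:E <= \int[P]_z \int[Q]_w lim_kernel z w)%E.
Proof.
rewrite -reg_energyE -(fubini_tonelli1 (fun p : T * T => (reg_kernel n p.1 p.2)%:E)) //.
rewrite -(fubini_tonelli1 (fun p : T * T => lim_kernel p.1 p.2)) //; last first.
  exact: measurable_lim_kernel.
apply: ge0_le_integral => //; first exact: measurable_lim_kernel.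
move=> [z w] _ /=.
have nr : \forall m \near \oo, ((reg_kernel n z w)%:E <= (reg_kernel m z w)%:E)%E.
  by exists n => // m /= nm; rewrite lee_fin reg_kernel_nd.
exact: (cvge_to_ge (@reg_kernel_cvg z w) nr).
Qed.

Lemma lim_energy_le c : (forall n, reg_energy n <= c) ->
  (\int[P]_z \int[Q]_w lim_kernel z w <= c%:E)%E.
Proof.
move=> Ec; rewrite -(fubini_tonelli1 (fun p : T * T => lim_kernel p.1 p.2)) //; last first.
  exact: measurable_lim_kernel.
rewrite (eq_integral (fun p : T * T =>
    limn (fun n => (reg_kernel n p.1 p.2)%:E))); last first.
  by move=> p _; apply/esym/cvg_lim => //; exact: reg_kernel_cvg.
have cv := @cvg_monotone_convergence _ _ _ (P \x Q)%E _ measurableT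
  (fun n (p : T * T) => (reg_kernel n p.1 p.2)%:E) (fun n => mH n) (fun n p _ => H0 n p).
have nd (p : T * T) : [set: T * T] p ->
    {homo (fun n => (reg_kernel n p.1 p.2)%:E) : m n / (m <= n)%N >-> (m <= n)%E}.
  by move=> _ m n mn; rewrite lee_fin reg_kernel_nd.
apply: cvge_to_le (cv nd) _; apply: nearW => n.
by rewrite fubini_tonelli1 // reg_energyE lee_fin.
Qed.

End Mutual.

Lemma reg_energyC (P Q : probability T R) n : reg_energy P Q n = reg_energy Q P n.
Proof.
apply: EFin_inj; rewrite -!reg_energyE.
have sym z w : reg_kernel n z w = reg_kernel n w z.
  by rewrite /reg_kernel /log_kernel cmod_distC [X in _ * X]mulrC.
rewrite (fubini_tonelli (fun p : T * T => (reg_kernel n p.1 p.2)%:E)).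
- by apply: eq_integral => z _; apply: eq_integral => w _; rewrite sym.
- by apply/measurable_EFinP; case: (reg_kernel_bkernel n).
- by move=> p; rewrite lee_fin reg_kernel_ge0.
Qed.

Lemma reg_energy_form (P Q : probability T R) (t : R) n k : (0 < k)%N ->
  2 / k%:R * ((\int[P]_z complex.Re (a z ^+ k) - t * \int[Q]_z complex.Re (a z ^+ k)) ^+ 2 +
    (\int[P]_z complex.Im (a z ^+ k) - t * \int[Q]_z complex.Im (a z ^+ k)) ^+ 2)
  <= reg_energy P P n - 2 * t * reg_energy P Q n + t ^+ 2 * reg_energy Q Q n.
Proof.
move=> k0; have bL := log_kernel_bkernel a_bmf a_half (eps_bounds1 n).
have E (A B : probability T R) :
    reg_energy A B n = mutual A B (log_kernel a (eps n)) + ln 2.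
  rewrite /reg_energy /reg_kernel mutualD //; last exact: bmf_cst.
  by congr (_ + _); rewrite /mutual Rintegral_prob_cst.
apply: le_trans (quad_form_log_kernel a_bmf a_half P Q t (eps_bounds1 n) k0) _.
have := reg_energyC P Q n; rewrite /quad_form !E => C.
(* The shift by [ln 2] adds [ln 2] times the squared total mass of P - t Q, a nonnegative amount. *)
have l2 : 0 <= ln 2 * (1 - t) ^+ 2 :> R by rewrite mulr_ge0 ?sqr_ge0 // ln_ge0 // ler1n.
by nra.
Qed.

End RegularizedEnergy.

Section EnergyScaling.
Variables (R : realType) (rho : R).
Hypothesis rho_gt0 : 0 < rho.
Local Notation T := (borelC R).
Variable J : set T.
Hypothesis mJ : measurable J.
Hypothesis J_bounded : forall z, J z -> cmod z <= rho / 2.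
Local Open Scope ereal_scope.

Local Notation dist z w := (cmod ((z : R[i]) - (w : R[i]))%R).

Let shift : R := (- (ln 2 / 2) - ln rho)%R.

Let energy_kernel_scale (z w : T) : J z -> J w ->
  - lne (dist z w)%:E =
  2^-1%:E * lim_kernel rho z w + shift%:E.
Proof.
move=> Jz Jw; have -> : dist z w = (cmod (scale rho z - scale rho w) * rho)%R.
  by rewrite cmod_scaleB ?J_bounded // divfK // gt_eqF.
rewrite /lim_kernel; set r := cmod (scale rho z - scale rho w)%R.
have : (0 <= r)%R by exact: cmod_ge0.
rewrite le_eqVlt => /predU1P[<-|r0].
  rewrite mul0r (le0_lneNy (lexx 0)) /= gt0_muley ?lte_fin // addye //.
  by rewrite gt0_muley ?lte_fin ?invr_gt0 // addye.
rewrite !lne_EFin ?mulr_gt0 // lnM ?posrE //.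
apply: (congr1 EFin (x := - (ln r + ln rho)) (y := 2^-1 * (2 * - ln r + ln 2) + shift))%R.
by rewrite /shift; lra.
Qed.

Let measurable_energy_kernel :
  measurable_fun setT (fun p : T * T => - lne (dist p.1 p.2)%:E).
Proof.
apply: measurableT_comp => //; apply: (measurableT_comp (@measurable_lne R)).
have -> : (fun p : T * T => dist p.1 p.2) =
  (fun p : T * T => Num.sqrt ((complex.Re (p.1 : R[i]) - complex.Re (p.2 : R[i])) ^+ 2 +
     (complex.Im (p.1 : R[i]) - complex.Im (p.2 : R[i])) ^+ 2))%R.
  by apply/funext => p; rewrite -Re_sub -Im_sub -sqr_cmod sqrtr_sqr ger0_norm ?cmod_ge0.
apply: (measurableT_comp (f := @Num.sqrt R)).
  by apply: continuous_measurable_fun; exact: sqrt_continuous.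
have mr (f : T -> R) : measurable_fun setT f ->
    measurable_fun setT (fun p : T * T => f p.1) /\
    measurable_fun setT (fun p : T * T => f p.2).
  by move=> mf; split; apply: measurableT_comp.
have [ar1 ar2] := mr _ (@measurable_Re R); have [ai1 ai2] := mr _ (@measurable_Im R).
by apply: measurable_funD; apply: measurable_funX; apply: measurable_funB.
Qed.

(** On J, - ln |z - w| is half of [lim_kernel] up to the constant [shift], so minimizing the energy
    and minimizing the [lim_kernel] energy amount to the same. *)
Lemma energy_scale (P : probability T R) : P J = 1 ->
  energy P = 2^-1%:E * (\int[P]_z \int[P]_w lim_kernel rho z w) + shift%:E.
Proof.
move=> PJ; have mL := measurable_lim_kernel rho_gt0.
have L0 z w : 0 <= lim_kernel rho z w by exact: lim_kernel_ge0.
have mLz : measurable_fun setT (fun z : T => \int[P]_w lim_kernel rho z w).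
  by apply: (@measurable_fun_fubini_tonelli_F _ _ T T R P
    (fun p : T * T => lim_kernel rho p.1 p.2)).
have mE : measurable_fun setT
    (fun z : T => \int[P]_w - lne (dist z w)%:E).
  (* The integrand of [energy] may change sign off J; its inner integral is measurable as a
     difference of two Tonelli integrals. *)
  under eq_fun do rewrite integralE.
  set f := fun p : T * T => - lne (dist p.1 p.2)%:E.
  have mp : measurable_fun setT f^\+ by exact: measurable_funepos.
  have mn : measurable_fun setT f^\- by exact: measurable_funeneg.
  apply: emeasurable_funB.
    have := @measurable_fun_fubini_tonelli_F _ _ T T R P f^\+ mp (funepos_ge0 f).
    congr measurable_fun; apply/funext => z; apply: eq_integral => w _.
    by rewrite !funeposE.
  have := @measurable_fun_fubini_tonelli_F _ _ T T R P f^\- mn (funeneg_ge0 f).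
  congr measurable_fun; apply/funext => z; apply: eq_integral => w _.
  by rewrite !funenegE.
have mhalf : measurable_fun setT (fun z : T => 2^-1%:E * \int[P]_w lim_kernel rho z w).
  exact: measurable_funeM.
have int0 z : 0 <= \int[P]_w lim_kernel rho z w by exact: integral_ge0.
rewrite /energy (eq_integral_full mJ PJ mE
  (g := fun z => 2^-1%:E * \int[P]_w lim_kernel rho z w + shift%:E)).
- rewrite integral_add_cst //; last by move=> z; rewrite mule_ge0 // lee_fin invr_ge0.
  by rewrite ge0_integralZl // lee_fin invr_ge0.
- by apply: emeasurable_funD => //; exact: measurable_cst.
move=> z Jz.
have mLw : measurable_fun setT (lim_kernel rho z).
  exact: (measurableT_comp mL (pair1_measurable _)).
have mEw : measurable_fun setT (fun w : T => - lne (dist z w)%:E).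
  exact: (measurableT_comp measurable_energy_kernel (pair1_measurable z)).
rewrite (eq_integral_full mJ PJ mEw (g := fun w => 2^-1%:E * lim_kernel rho z w + shift%:E)).
- rewrite integral_add_cst //; last by move=> w; rewrite mule_ge0 // lee_fin invr_ge0.
    by rewrite ge0_integralZl // lee_fin invr_ge0.
  exact: measurable_funeM.
- apply: emeasurable_funD; last exact: measurable_cst.
  exact: measurable_funeM.
- by move=> w Jw; exact: energy_kernel_scale.
Qed.

End EnergyScaling.

(** * Energies of the fibre-averaged measure *)

Section FibreAveraging.
Variables (R : realType) (F : {poly R[i]}) (rho : R).
Hypotheses (F_gt1 : (1 < size F)%N) (rho_gt0 : 0 < rho).
Local Notation T := (borelC R).
Local Notation D := (size F).-1.
Variables (J : set T) (mu : probability T R).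
Hypotheses (mJ : measurable J) (muJ : mu J = 1%E).
Hypothesis J_bounded : forall z, J z -> cmod z <= rho / 2.
Hypothesis J_saturated : forall z x : T, J z -> F.[x] = F.[z] -> J x.

Let sigma := pullback F_gt1 mu.

Let D_gt0 : (0 < D)%N. Proof. by case: (size F) F_gt1 => [|[|n]]. Qed.

Let DR : 0 < D%:R :> R. Proof. by rewrite ltr0n. Qed.

Let fibre_J (z x : T) : J z -> (x : R[i]) \in fibre F F.[z] -> J x.
Proof. by move=> Jz; rewrite mem_fibre // => /eqP; exact: J_saturated. Qed.

Let mean_eq (phi psi : T -> \bar R) : measurable_fun setT phi -> measurable_fun setT psi ->
  (forall x, 0 <= phi x)%E -> (forall x, 0 <= psi x)%E ->
  (forall z, J z -> (D%:R^-1)%:E * \sum_(x <- fibre F F.[z]) phi x = psi z)%E ->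
  (\int[sigma]_x phi x = \int[mu]_z psi z)%E.
Proof.
move=> mphi mpsi phi0 psi0 E; rewrite integral_pullback //.
by apply: (eq_integral_full mJ muJ) => //; exact: measurable_fibre_sum.
Qed.

Let fibre_mean_cst (z : T) (c : \bar R) :
  ((D%:R^-1)%:E * \sum_(x <- fibre F F.[z]) c = c)%E.
Proof.
rewrite big_const_seq count_predT size_fibre //.
have -> n : iter n (fun x : \bar R => c + x)%E 0%E = (n%:R%:E * c)%E.
  elim: n => [|n IH]; first by rewrite mul0e.
  by rewrite iterS IH -natr1 addrC EFinD ge0_muleDl ?lee_fin // mul1e.
by rewrite muleA -EFinM mulVf ?gt_eqF // mul1e.
Qed.

Lemma pullback_full : sigma J = 1%E.
Proof.
have m1 : measurable_fun setT (fun x : T => (\1_J x : R)%:E).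
  by apply/measurable_EFinP; exact: measurable_indic.
have := @mean_eq (fun x => (\1_J x)%:E) (fun=> 1%E) m1 (measurable_cst _).
rewrite integral_indic // setIT integral_prob_cst; apply => //.
move=> z Jz; rewrite -[RHS](fibre_mean_cst z); congr (_ * _)%E.
rewrite big_seq [RHS]big_seq; apply: eq_bigr => x xz.
by rewrite indicE mem_set //; exact: fibre_J xz.
Qed.

Let dist2 (z x : T) : R := cmod (scale rho z - scale rho x) ^+ 2.

(** The factorization of F - F(w), evaluated at z. The fibre stays in J, where [scale] is a genuine
    homothety, and each of the D factors brings 1/rho. *)
Let prod_dist (z w : T) : J z -> J w ->
  \prod_(x <- fibre F F.[w]) cmod (scale rho z - scale rho (x : T)) =
  cmod (F.[z] - F.[w]) / (cmod (lead_coef F) * rho ^+ D).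
Proof.
move=> Jz Jw; rewrite (horner_fibre F_gt1) cmodM cmod_prod invfM mulrACA mulfV; last first.
  by rewrite cmod_eq0 lead_coef_eq0 -size_poly_gt0 ltnW.
rewrite mul1r big_seq.
rewrite (eq_bigr (fun x => cmod ((z : R[i]) - x) * rho^-1)); last first.
  by move=> x xw; rewrite cmod_scaleB ?J_bounded //; exact: fibre_J xw.
rewrite -big_seq big_split /=; congr (_ * _).
by rewrite big_const_seq count_predT iter_mulr_1 size_fibre // exprVn.
Qed.

Let reg_mean n (z w : T) : \bar R :=
  ((D%:R^-1)%:E * \sum_(x <- fibre F F.[w]) (reg_kernel rho n z x)%:E)%E.

Let reg_mean_le n (z z' w : T) : J z -> J z' -> J w -> F.[z] = F.[z'] ->
  (reg_mean n z' w <= D%:R%:E * reg_mean n z w + (ln 4)%:E)%E.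
Proof.
move=> Jz Jz' Jw zz'; rewrite /reg_mean !sumEFin -!EFinM -EFinD lee_fin.
set e : R := n.+2%:R^-1.
have e0 : 0 < e by rewrite invr_gt0.
have e2 : e <= 2^-1 by rewrite lef_pV2 ?posrE // ler_nat.
have d01 y x : 0 <= dist2 y x <= 1.
  rewrite sqr_ge0 /= expr_le1 ?cmod_ge0 //; exact: cmod_scaleB_le1.
have u0 y x : 0 < e + (1 - e) * dist2 y x.
  by have /andP[? ?] := d01 y x; rewrite ltr_pwDl // mulr_ge0 // subr_ge0; lra.
have wt (y x : T) : 2^-1 <= (1 - cmod (scale rho y) ^+ 2) * (1 - cmod (scale rho x) ^+ 2) <= 1.
  have /andP[z0 z1] := weight_bounds (scale_half rho_gt0) y.
  have /andP[w0 w1] := weight_bounds (scale_half rho_gt0) x.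
  move: z0 z1 w0 w1; set A := 1 - _; set B := 1 - _ => z0 z1 w0 w1.
  by apply/andP; split; nra.
(* With the shift absorbed as a division by 2, the argument lies between a quarter of e + (1 - e)
   [dist2] and the whole of it, as the weights are in [1/2, 1] and e is at most 1/2. This is the
   origin of [ln 4]. *)
have HE y x : reg_kernel rho n y x =
    - ln ((dist2 y x + e * ((1 - cmod (scale rho y) ^+ 2) * (1 - cmod (scale rho x) ^+ 2))) / 2).
  have /andP[? _] := d01 y x; have /andP[? _] := wt y x.
  rewrite /reg_kernel /log_kernel -/e -/(dist2 y x) ln_div ?posrE //; first by ring.
  by rewrite ltr_wpDl // mulr_gt0 //; lra.
have := @regularized_sum_le R _ (fibre F F.[w]) (dist2 z) (dist2 z')
  (reg_kernel rho n z) (reg_kernel rho n z') e.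
rewrite size_fibre // => H.
have {}H : \sum_(x <- fibre F F.[w]) reg_kernel rho n z' x <=
    D%:R * \sum_(x <- fibre F F.[w]) reg_kernel rho n z x + D%:R * ln 4.
  apply: H => //.
  - by rewrite e0; lra.
  - by rewrite /dist2 !prodrXl !prod_dist // zz'.
  - move=> x _; have /andP[? ?] := d01 z x; have /andP[? ?] := wt z x.
    rewrite HE lerN2 ler_ln ?posrE ?u0 //; first by nra.
    by rewrite divr_gt0 // ltr_wpDl // mulr_gt0 //; lra.
  - move=> x _; have /andP[? ?] := d01 z' x; have /andP[? ?] := wt z' x.
    rewrite HE -lerBlDr -opprD lerN2 -lnM ?posrE //; last first.
      by rewrite divr_gt0 // ltr_wpDl // mulr_gt0 //; lra.
    rewrite ler_ln ?posrE ?u0 //; first by nra.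
    by rewrite mulr_gt0 // divr_gt0 // ltr_wpDl // mulr_gt0 //; lra.
rewrite mulrA mulfV ?gt_eqF // mul1r ler_pdivrMl // mulrDr //.
Qed.

Let lim_mean (z z' w : T) : J z -> J z' -> J w -> F.[z] = F.[z'] ->
  (\sum_(x <- fibre F F.[w]) lim_kernel rho z' x =
   \sum_(x <- fibre F F.[w]) lim_kernel rho z x)%E.
Proof.
move=> Jz Jz' Jw zz'; rewrite /lim_kernel !big_split /=; congr (_ + _)%E.
have ninf (y x : T) : (0 <= - lne (cmod (scale rho y - scale rho x)%R)%:E)%E.
  by rewrite oppe_ge0 lne_le0 lee_fin cmod_scaleB_le1.
rewrite -ge0_sume_distrr; last by move=> x _; exact: ninf.
rewrite -ge0_sume_distrr; last by move=> x _; exact: ninf.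
congr (_ * _)%E.
rewrite !sum_lne_prod; try by move=> *; exact: cmod_ge0.
by rewrite !prod_dist // zz'.
Qed.

Let mreg n (z : T) : measurable_fun setT (fun w : T => (reg_kernel rho n z w)%:E).
Proof.
apply/measurable_EFinP; have [m _] := reg_kernel_bkernel rho_gt0 n.
exact: (measurableT_comp m (pair1_measurable z)).
Qed.

Let reg0 n (z w : T) : (0 <= (reg_kernel rho n z w)%:E)%E.
Proof. by rewrite lee_fin reg_kernel_ge0. Qed.

Let mreg_int n (P : probability T R) :
  measurable_fun setT (fun z : T => \int[P]_w (reg_kernel rho n z w)%:E)%E.
Proof.
have m : measurable_fun setT (fun p : T * T => (reg_kernel rho n p.1 p.2)%:E).
  by apply/measurable_EFinP; have [] := reg_kernel_bkernel rho_gt0 n.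
exact: (@measurable_fun_fubini_tonelli_F _ _ T T R P _ m (fun p => @reg0 n p.1 p.2)).
Qed.

Let mlim (z : T) : measurable_fun setT (lim_kernel rho z).
Proof. exact: (measurableT_comp (measurable_lim_kernel rho_gt0) (pair1_measurable z)). Qed.

Let lim0 (z w : T) : (0 <= lim_kernel rho z w)%E.
Proof. exact: lim_kernel_ge0. Qed.

Let mlim_int (P : probability T R) :
  measurable_fun setT (fun z : T => \int[P]_w lim_kernel rho z w)%E.
Proof.
exact: (@measurable_fun_fubini_tonelli_F _ _ T T R P _ (measurable_lim_kernel rho_gt0)
  (fun p => @lim0 p.1 p.2)).
Qed.

Let mmean (phi : T -> \bar R) : measurable_fun setT phi -> (forall x, 0 <= phi x)%E ->
  measurable_fun setT (fun z : T => (D%:R^-1)%:E * \sum_(x <- fibre F F.[z]) phi x)%E.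
Proof. exact: measurable_fibre_sum. Qed.

Let mean0 (phi : T -> \bar R) (z : T) : (forall x, 0 <= phi x)%E ->
  (0 <= (D%:R^-1)%:E * \sum_(x <- fibre F F.[z]) phi x)%E.
Proof. by move=> phi0; rewrite mule_ge0 ?sume_ge0 // lee_fin invr_ge0 ltW. Qed.

Let int_affine (phi : T -> \bar R) : measurable_fun setT phi ->
  (forall x, 0 <= phi x)%E ->
  (\int[mu]_w (D%:R%:E * phi w + (ln 4)%:E) = D%:R%:E * \int[mu]_w phi w + (ln 4)%:E)%E.
Proof.
move=> mphi phi0; rewrite integral_add_cst.
- by rewrite ge0_integralZl // lee_fin ltW.
- exact: measurable_funeM.
- by move=> w; rewrite mule_ge0 // lee_fin ltW.
Qed.

Let int_affine_meas (phi : T -> \bar R) : measurable_fun setT phi ->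
  measurable_fun setT (fun w : T => D%:R%:E * phi w + (ln 4)%:E)%E.
Proof.
by move=> mphi; apply: emeasurable_funD; [exact: measurable_funeM | exact: measurable_cst].
Qed.

Let ln4_ge0 : (0 <= (ln 4)%:E :> \bar R)%E.
Proof. by rewrite lee_fin ln_ge0 // ler1n. Qed.

Let affine_ge0 (phi : T -> \bar R) w : (forall x, 0 <= phi x)%E ->
  (0 <= D%:R%:E * phi w + (ln 4)%:E)%E.
Proof. by move=> phi0; rewrite adde_ge0 // mule_ge0 // lee_fin ltW. Qed.

Let reg_potential_le n (z z' : T) : J z -> J z' -> F.[z] = F.[z'] ->
  (\int[sigma]_w (reg_kernel rho n z' w)%:E <=
   D%:R%:E * \int[sigma]_w (reg_kernel rho n z w)%:E + (ln 4)%:E)%E.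
Proof.
move=> Jz Jz' zz'; rewrite !integral_pullback //.
have mm y := mmean (mreg n y) (reg0 n y); have m0 y w := mean0 w (reg0 n y).
rewrite -int_affine //; apply: (le_integral_full mJ muJ) => //.
- exact: int_affine_meas.
- by move=> w; exact: (affine_ge0 w (m0 z)).
- by move=> w Jw; exact: reg_mean_le.
Qed.

(** Points of one fibre have comparable regularized potentials, so averaging the outer variable over
    fibres changes the energy in a controlled way; the factor D is harmless because only finiteness
    is drawn from this bound. *)
Lemma reg_energy_pullback_le n :
  reg_energy rho sigma sigma n <= D%:R * reg_energy rho mu sigma n + ln 4.
Proof.
rewrite -lee_fin EFinD EFinM -!(reg_energyE rho_gt0).
have g0 z : (0 <= \int[sigma]_w (reg_kernel rho n z w)%:E)%E by exact: integral_ge0.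
have mg := mreg_int n sigma.
rewrite {1}integral_pullback // -int_affine //.
apply: (le_integral_full mJ muJ) => //.
- exact: mmean.
- exact: int_affine_meas.
- by move=> z; exact: mean0.
- by move=> z; exact: (affine_ge0 z g0).
move=> z Jz; rewrite -[leRHS](fibre_mean_cst z); apply: lee_wpmul2l.
  by rewrite lee_fin invr_ge0 ltW.
rewrite big_seq [leRHS]big_seq; apply: lee_sum => x xz.
apply: reg_potential_le => //; first exact: fibre_J xz.
by move: xz; rewrite mem_fibre // => /eqP.
Qed.

Lemma lim_energy_pullback :
  (\int[sigma]_z \int[sigma]_w lim_kernel rho z w =
   \int[mu]_z \int[sigma]_w lim_kernel rho z w)%E.
Proof.
apply: mean_eq; try exact: mlim_int; try by move=> z; exact: integral_ge0.
move=> z Jz; rewrite -[RHS](fibre_mean_cst z); congr (_ * _)%E.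
rewrite big_seq [RHS]big_seq; apply: eq_bigr => x xz.
rewrite !integral_pullback //; try exact: mlim.
apply: (eq_integral_full mJ muJ); try exact: mmean.
move=> w Jw; congr (_ * _)%E; apply: lim_mean => //; first exact: fibre_J xz.
by move: xz; rewrite mem_fibre // => /eqP.
Qed.

End FibreAveraging.

(** * Moments of a measure of least energy on a saturated set *)

Section Minimizer.
Variables (R : realType) (F : {poly R[i]}) (rho : R).
Hypotheses (F_gt1 : (1 < size F)%N) (rho_gt0 : 0 < rho).
Local Notation T := (borelC R).
Local Notation D := (size F).-1.
Variables (J : set T) (mu : probability T R).
Hypotheses (mJ : measurable J) (mu_eq : is_equilibrium_measure J mu).
Hypothesis J_bounded : forall z, J z -> cmod z <= rho / 2.
Hypothesis J_saturated : forall z x : T, J z -> F.[x] = F.[z] -> J x.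

Let sigma := pullback F_gt1 mu.
Let a := scale rho.

Let muJ : mu J = 1%E. Proof. by case: mu_eq. Qed.

Let D_gt0 : (0 < D)%N. Proof. by case: (size F) F_gt1 => [|[|n]]. Qed.

Let DR : 0 < D%:R :> R. Proof. by rewrite ltr0n. Qed.

Let sigmaJ : sigma J = 1%E. Proof. exact: pullback_full. Qed.

Let lim_energy_ge0 (P Q : probability T R) :
  (0 <= \int[P]_z \int[Q]_w lim_kernel rho z w)%E.
Proof. by apply: integral_ge0 => z _; apply: integral_ge0 => w _; exact: lim_kernel_ge0. Qed.

Let lim_energy_mu : exists e : R,
  (\int[mu]_z \int[mu]_w lim_kernel rho z w = e%:E)%E.
Proof.
have [_ + _] := mu_eq; rewrite (energy_scale rho_gt0 mJ J_bounded muJ).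
case: (\int[mu]_z _)%E (lim_energy_ge0 mu mu) => [e _ _|_|//].
  by exists e.
by rewrite gt0_muley ?lte_fin ?invr_gt0.
Qed.

Let eq_moments k : (0 < k)%N ->
  \int[mu]_z complex.Re (a z ^+ k) = \int[sigma]_z complex.Re (a z ^+ k) /\
  \int[mu]_z complex.Im (a z ^+ k) = \int[sigma]_z complex.Im (a z ^+ k).
Proof.
move=> k0; have [e Ee] := lim_energy_mu.
have form t n := reg_energy_form rho_gt0 mu sigma t n k0.
have me n : reg_energy rho mu mu n <= e.
  by rewrite -lee_fin -Ee; exact: reg_energy_le.
have sle n := reg_energy_pullback_le F_gt1 rho_gt0 mJ muJ J_bounded J_saturated n.
rewrite -/sigma in sle.
have kR : 0 < 2 / k%:R :> R by rewrite divr_gt0 // ltr0n.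
(* Positivity at t = 1/D: the cross term enters with - 2/D and returns through the bound on sigma
   with only + 1/D, so the net coefficient - 1/D bounds it uniformly in n. *)
have bound n : reg_energy rho mu sigma n <= D%:R * e + ln 4 / D%:R.
  have := form D%:R^-1 n; have := me n; have := sle n.
  set x := reg_energy rho mu sigma n; set y := reg_energy rho sigma sigma n.
  set q := _ * (_ + _) => h1 h2 h3.
  have q0 : 0 <= q.
    by rewrite /q mulr_ge0 ?(ltW kR) // addr_ge0 // sqr_ge0.
  have h4 : D%:R^-1 ^+ 2 * y <= D%:R^-1 ^+ 2 * (D%:R * x + ln 4).
    by rewrite ler_wpM2l // sqr_ge0.
  have h5 : D%:R^-1 ^+ 2 * (D%:R * x + ln 4) = D%:R^-1 * x + D%:R^-1 ^+ 2 * ln 4.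
    by field; rewrite gt_eqF.
  have h6 : D%:R^-1 * x <= e + D%:R^-1 ^+ 2 * ln 4 by lra.
  have : D%:R * (D%:R^-1 * x) <= D%:R * (e + D%:R^-1 ^+ 2 * ln 4).
    by rewrite ler_wpM2l // ltW.
  have -> : D%:R * (D%:R^-1 * x) = x by field; rewrite gt_eqF.
  have -> // : D%:R * (e + D%:R^-1 ^+ 2 * ln 4) = D%:R * e + ln 4 / D%:R.
  by field; rewrite gt_eqF.
have := lim_energy_le rho_gt0 bound; have := lim_energy_ge0 mu sigma.
case Ex : (\int[mu]_z \int[sigma]_w lim_kernel rho z w)%E => [x| |] // _ _.
have Esigma : (\int[sigma]_z \int[sigma]_w lim_kernel rho z w = x%:E)%E.
  by rewrite (lim_energy_pullback F_gt1 rho_gt0 mJ muJ J_bounded J_saturated).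
have ex : e <= x.
  have [_ _ /(_ sigma sigmaJ)] := mu_eq.
  rewrite (energy_scale rho_gt0 mJ J_bounded muJ).
  rewrite (energy_scale rho_gt0 mJ J_bounded sigmaJ) Ee Esigma.
  by rewrite -!EFinM -!EFinD lee_fin; lra.
have [A [A' [B [B' [-> -> -> -> form1]]]]] : exists A A' B B',
    [/\ \int[mu]_z complex.Re (a z ^+ k) = A, \int[sigma]_z complex.Re (a z ^+ k) = A',
      \int[mu]_z complex.Im (a z ^+ k) = B, \int[sigma]_z complex.Im (a z ^+ k) = B' &
      forall n, 2 / k%:R * ((A - A') ^+ 2 + (B - B') ^+ 2) <=
        reg_energy rho mu mu n - 2 * reg_energy rho mu sigma n + reg_energy rho sigma sigma n].
  do 4 eexists; split; try by [].
  by move=> n; have := form 1 n; rewrite !mul1r mulr1 expr1n mul1r.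
set d2 := _ + _ in form1.
(* Positivity at t = 1, with the outer energies replaced by their limits. In the limit the left side
   becomes x, and as minimality gives e <= x, the moment gap [d2] cannot be positive. *)
have ub n : reg_energy rho mu sigma n <= (e + x - 2 / k%:R * d2) / 2.
  have := form1 n; have := me n.
  have : reg_energy rho sigma sigma n <= x.
    by rewrite -lee_fin -Esigma; exact: reg_energy_le.
  by lra.
have := lim_energy_le rho_gt0 ub; rewrite Ex lee_fin => h.
have d0 : 2 / k%:R * d2 <= 0 by lra.
have {}d0 : d2 <= 0 by rewrite -(pmulr_rle0 _ kR).
have d2e : d2 == 0 by rewrite eq_le d0 addr_ge0 // sqr_ge0.
move: d2e; rewrite paddr_eq0 ?sqr_ge0 // !sqrf_eq0 !subr_eq0.
by move=> /andP[/eqP -> /eqP ->].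
Qed.

Let integral_sigma (u : T -> R) (c : R) : bmf u -> (forall x, `|u x| <= 1) ->
  (forall z, J z -> \sum_(x <- fibre F F.[z]) u x = D%:R * c) ->
  \int[sigma]_z u z = c.
Proof.
move=> bu u1 uc; have iu := bmf_integrable sigma bu.
(* [integral_pullback] is about nonnegative functions; adding 1 brings [u] into its scope. *)
have u0 x : (0 <= (u x + 1)%:E)%E.
  by rewrite lee_fin; have := u1 x; rewrite ler_norml => /andP[]; lra.
have mu1 : measurable_fun setT (fun x => (u x + 1)%:E).
  by apply/measurable_EFinP; have [] := bmfD bu (bmf_cst T 1).
have : (\int[sigma]_x (u x + 1)%:E = (c + 1)%:E)%E.
  rewrite integral_pullback // -(integral_prob_cst mu (c + 1)).
  apply: (eq_integral_full mJ muJ); first exact: measurable_fibre_sum.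
    exact: measurable_cst.
  move=> z Jz; rewrite sumEFin -EFinM big_split /= uc //; congr (_%:E).
  rewrite big_const_seq count_predT size_fibre // iter_addr_0 mulrDr mulKf ?gt_eqF //.
  by rewrite mulVf // gt_eqF.
under eq_integral do rewrite EFinD.
rewrite integralD //; last exact: (bmf_integrable sigma (bmf_cst T 1)).
rewrite integral_prob_cst EFinD /Rintegral => E.
have fi : (\int[sigma]_x (u x)%:E)%E \is a fin_num by exact: integrable_fin_num iu.
apply: (@addIr _ 1); apply: EFin_inj.
by rewrite EFinD fineK // E -EFinD.
Qed.

Let integral_mu (u : T -> R) (v : T -> R) : bmf u -> measurable_fun setT v ->
  forall k, (forall z, J z -> v z = rho ^+ k * u z) ->
  \int[mu]_z v z = rho ^+ k * \int[mu]_z u z.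
Proof.
move=> bu mv k vu; rewrite -RintegralZl //; last exact: bmf_integrable.
congr fine; apply: (eq_integral_full mJ muJ).
- exact/measurable_EFinP.
- by apply/measurable_EFinP; have [] := bmfZ (rho ^+ k) bu.
- by move=> z Jz; rewrite vu.
Qed.

Let a_bmf := cbmf_scale rho_gt0.

Let scaleX (z : T) k : J z -> a z ^+ k = (rho ^- k)%:C * (z : R[i]) ^+ k.
Proof.
move=> Jz; rewrite /a scale_small ?J_bounded // exprMn -rmorphXn.
by rewrite exprVn.
Qed.

Lemma moment_minimizer k : (0 < k < D)%N -> moment mu k = power_sum k F / D%:R.
Proof.
move=> /andP[k0 kD]; have [eRe eIm] := eq_moments k0.
have rk : rho ^+ k != 0 by rewrite expf_neq0 // gt_eqF.
have [ar ai] := cbmfX k a_bmf.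
have a1 z : cmod (a z ^+ k) <= 1.
  rewrite cmodX exprn_ile1 ?cmod_ge0 //.
  by apply: le_trans (scale_half rho_gt0 z) _; lra.
have fibre_sum (z : T) : J z ->
    \sum_(x <- fibre F F.[z]) a x ^+ k = (rho ^- k)%:C * power_sum k F.
  move=> Jz; rewrite -(@power_sum_fibre _ _ F_gt1 F.[z]) ?k0 // mulr_sumr.
  rewrite big_seq [RHS]big_seq; apply: eq_bigr => x; rewrite mem_fibre // => /eqP xz.
  by rewrite scaleX //; exact: J_saturated Jz xz.
have mk : measurable_fun setT (fun z : T => (z : R[i]) ^+ k : T).
  have := @measurable_horner R 'X^k; congr measurable_fun.
  by apply/funext => z; rewrite hornerXn.
have mRe := integral_mu ar (measurableT_comp (@measurable_Re R) mk).
have mIm := integral_mu ai (measurableT_comp (@measurable_Im R) mk).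
have sRe : \int[sigma]_z complex.Re (a z ^+ k) =
    D%:R^-1 * (rho ^- k * complex.Re (power_sum k F)).
  apply: integral_sigma => //.
    by move=> x; exact: le_trans (Re_le_cmod _) (a1 x).
  move=> z Jz; rewrite mulVKf ?gt_eqF // -Re_realM -(fibre_sum z Jz).
  by rewrite Re_sum.
have sIm : \int[sigma]_z complex.Im (a z ^+ k) =
    D%:R^-1 * (rho ^- k * complex.Im (power_sum k F)).
  apply: integral_sigma => //.
    by move=> x; exact: le_trans (Im_le_cmod _) (a1 x).
  move=> z Jz; rewrite mulVKf ?gt_eqF //.
  have -> : rho ^- k * complex.Im (power_sum k F) = complex.Im ((rho ^- k)%:C * power_sum k F).
    by rewrite Im_mul /= mul0r addr0.
  by rewrite -(fibre_sum z Jz) Im_sum.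
have pull (w : R[i]) : w / D%:R = (D%:R^-1)%:C * w.
  by rewrite fmorphV rmorph_nat mulrC.
rewrite pull /moment (mRe k) ?(mIm k) => [|z Jz|z Jz]; last 2 first.
- by rewrite scaleX // Im_mul /= mul0r addr0 mulVKf.
- by rewrite scaleX // Re_realM mulVKf.
rewrite eRe eIm sRe sIm; apply/eqP; rewrite eq_complex /=.
case: (power_sum k F) => x y /=.
by rewrite mulrCA mulVKf // mul0r subr0 mulrCA mulVKf // mul0r addr0 !eqxx.
Qed.

End Minimizer.

(** * The Julia set *)

Section Julia.
Variables (R : realType) (f : nat -> {poly R[i]}).
Local Notation C := (R[i]^o).
Local Notation sphere := (riemann_sphere R).

Lemma strictly_increasing_ge (phi : nat -> nat) n :
  {homo phi : m n / (m < n)%N} -> (n <= phi n)%N.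
Proof.
move=> hphi; elim: n => // n IH; apply: leq_ltn_trans IH _; exact: hphi.
Qed.

Lemma open_preimage_Some (U : set sphere) : open U -> open [set z : C | U (Some z)].
Proof.
move=> oU; rewrite openE => z Uz.
by have := open_nbhs_nbhs (conj oU Uz : open_nbhs (Some z : sphere) U).
Qed.

Lemma open_fatou_in_plane : open [set z : C | fatou_set f (Some z)].
Proof.
rewrite openE => z [U [oU Uz nU]].
have oV := open_preimage_Some oU; rewrite openE in oV.
by apply: filterS (oV z Uz) => w Uw; exists U.
Qed.

Lemma measurable_julia : measurable (julia_in_plane f : set (borelC R)).
Proof.
have -> : (julia_in_plane f : set (borelC R)) = ~` [set z : C | fatou_set f (Some z)] by [].
by apply: measurableC; apply: sub_sigma_algebra; exact: open_fatou_in_plane.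
Qed.

Lemma composition_factor l n z x : (l <= n)%N ->
  (composition f l).[x] = (composition f l).[z] ->
  (composition f n).[x] = (composition f n).[z].
Proof.
move=> ln e; rewrite -(subnK ln); elim: (n - l)%N => [|m IH]; first by rewrite add0n.
by rewrite addSn !horner_composition IH.
Qed.

(** For n >= l, F_n factors through F = F_l, so its values on the open set of points y with F(y) in
    F(B) are already taken on the small disc B around z; normality is carried over from B. *)
Lemma fatou_saturated l z x : (1 < size (composition f l))%N ->
  (composition f l).[x] = (composition f l).[z] ->
  fatou_set f (Some z) -> fatou_set f (Some x).
Proof.
set F := composition f l => F1 Fxz [U [oU Uz nU]].
have [e e0 eU] : exists2 e : R, 0 < e & forall y : C, cmod ((y : R[i]) - z) < e -> U (Some y).
  by have /open_cmod := open_preimage_Some oU; apply.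
(* A point of the square [Q] of half-side r is at distance at most 2 r < e from z. The compact
   square supplies uniform convergence on the whole open disc [B]. *)
pose r := e / 3.
have r0 : 0 < r by rewrite divr_gt0.
pose Q := [set y : C | complex.Re z - r <= complex.Re y <= complex.Re z + r /\
                       complex.Im z - r <= complex.Im y <= complex.Im z + r].
pose B := [set y : C | cmod ((y : R[i]) - z) < r].
have BQ : B `<=` Q.
  move=> y; rewrite /B /= => yr.
  have := le_lt_trans (Re_le_cmod _) yr; have := le_lt_trans (Im_le_cmod _) yr.
  rewrite Re_sub Im_sub !ltr_norml => /andP[? ?] /andP[? ?].
  by split; apply/andP; split; lra.
have QU : Some @` Q `<=` (U : set sphere).
  move=> _ [y [/andP[a1 a2] /andP[b1 b2]] <-]; apply: eU.
  have -> : (y : R[i]) - z = (complex.Re y - complex.Re z)%:C +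
       'i%C * (complex.Im y - complex.Im z)%:C.
    rewrite -Re_sub -Im_sub; exact: complexE.
  apply: le_lt_trans (cmodD _ _) _; rewrite cmodM !cmod_real.
  have -> : cmod ('i%C : R[i]) = 1 by rewrite /cmod /= expr0n /= expr1n add0r sqrtr1.
  have re : r + r < e by rewrite /r; lra.
  apply: le_lt_trans re; rewrite mul1r lerD // ler_norml; apply/andP; split; lra.
have cQ : compact (Some @` Q : set sphere).
  apply: continuous_compact; last exact: compact_square.
  by apply: continuous_subspaceT; exact: one_point_compactification_some_continuous.
have oB : open B.
  apply/open_cmod => y By; exists (r - cmod ((y : R[i]) - z)); first by rewrite subr_gt0.
  move=> w wy; rewrite /B /=.
  have -> : (w : R[i]) - z = (w - y) + (y - z) by rewrite addrA subrK.
  by apply: le_lt_trans (cmodD _ _) _; rewrite -ltrBrDr.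
pose V := (horner F : C -> C) @` B.
have oV : open V by exact: open_image_horner.
have oFV : open ((horner F : C -> C) @^-1` V).
  by apply: open_comp => // y _; exact: continuous_horner_complex.
have VFx : V F.[x] by exists z => //; rewrite /B /= subrr cmod0.
exists (Some @` [set y : C | V F.[y]]); split.
- exact: one_point_compactification_open_some.
- by exists x.
move=> phi hphi; have [psi [hpsi [h hK]]] := nU phi hphi.
exists psi; split => //.
(* An arbitrary selection suffices: convergence is uniform on [Q], so composing the limit with [g]
   requires no continuity of [g]. *)
have /choice [g Hg] : forall y : C, exists y' : C, V F.[y] -> B y' /\ F.[y'] = F.[y].
  move=> y; have [[y' By' Fy']|nV] := pselect (V F.[y]); first by exists y'.
  by exists y => /nV.
exists (fun x => if x is Some y then h (Some (g y)) else None).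
move=> K cK KW eps eps0.
have [N _ HN] := hK (Some @` Q) cQ QU eps eps0.
exists (maxn N l) => // n /=; rewrite geq_max => /andP[Nn ln] _ /KW [y Vy <-].
have [By' Fy'] := Hg y Vy.
have := HN n Nn (Some (g y)); rewrite /sphere_map /=.
have ln1 : (l <= (phi (psi n)).+1)%N.
  rewrite (leq_trans ln) // (leq_trans (strictly_increasing_ge n hpsi)) //.
  by rewrite leqW // strictly_increasing_ge.
have /= -> := composition_factor ln1 Fy'; apply.
by exists (g y) => //; exact: BQ.
Qed.

Hypothesis f_regular : regular_polynomial_sequence f.

Lemma regular_growth : exists2 M : R, 1 <= M & forall n z, (0 < n)%N ->
  M <= cmod z -> 2 * cmod z <= cmod (f n).[z].
Proof.
have [df [A1 [A2 [A3 [A10 A20 _ Hf]]]]] := f_regular.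
have A14 : 0 < 4 / A1 by rewrite divr_gt0.
(* [2 * A2 <= r - 1] keeps the lower terms below half of the leading one by a geometric sum;
   [4 / A1 <= r] makes the remaining half, at least A1 r^2 / 2, exceed 2 r. *)
exists (1 + 2 * A2 + 4 / A1); first by lra.
move=> n z n0; have [lead coefs _] := Hf n n0; have d2 := df n n0.
set r := cmod z => rM.
have r1 : 1 <= r by lra.
set p := f n in lead coefs d2 *; set d := deg p in coefs d2.
set c := cmod (lead_coef p) in lead coefs.
have c0 : 0 < c by exact: lt_le_trans lead.
have sp : size p = d.+1.
  by rewrite /d /deg prednK // lt0n; apply: contraTneq d2; rewrite /d /deg => ->.
have -> : p.[z] = lead_coef p * z ^+ d + \sum_(j < d) p`_j * z ^+ j.
  by rewrite horner_coef sp big_ord_recr /= addrC lead_coefE sp.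
set S := \sum_(j < d) _.
have SE : cmod S <= A2 * c * \sum_(j < d) r ^+ j.
  rewrite mulr_sumr (le_trans (cmod_sum _ _)) //; apply: ler_sum => j _.
  by rewrite cmodM cmodX ler_wpM2r ?exprn_ge0 ?cmod_ge0 // coefs.
have geo : (r - 1) * \sum_(j < d) r ^+ j <= r ^+ d by rewrite -subrX1 lerBlDr lerDl.
set G := \sum_(j < d) r ^+ j in SE geo.
have G0 : 0 <= G by apply: sumr_ge0 => j _; rewrite exprn_ge0 // cmod_ge0.
have AG : 2 * (A2 * G) <= r ^+ d by nra.
have lb : c * r ^+ d - cmod S <= cmod (lead_coef p * z ^+ d + S).
  have := cmodB (lead_coef p * z ^+ d) (- S).
  by rewrite opprK cmodN cmodM cmodX.
apply: le_trans lb.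
have rd : r * r <= r ^+ d by rewrite -expr2 ler_weXn2l.
have A1r : 4 <= A1 * r.
  by rewrite mulrC -ler_pdivrMr //; lra.
have half : c * r ^+ d <= 2 * (c * r ^+ d - cmod S).
  suff : 2 * cmod S <= c * r ^+ d by lra.
  have : c * (2 * (A2 * G)) <= c * r ^+ d by rewrite ler_pM2l.
  by lra.
have : A1 * (r * r) <= c * r ^+ d.
  by apply: ler_pM => //; [exact: ltW | nra].
have : 4 * r <= A1 * (r * r) by rewrite mulrA ler_pM2r //; lra.
by lra.
Qed.

Lemma composition_growth : exists2 M : R, 1 <= M & forall n z,
  M <= cmod z -> 2 ^+ n * cmod z <= cmod (composition f n).[z].
Proof.
have [M M1 HM] := regular_growth; exists M => // n z zM.
elim: n => [|n IH]; first by rewrite /= hornerX expr0 mul1r.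
rewrite horner_composition exprS -mulrA.
apply: le_trans (HM n.+1 _ isT _).
  by rewrite ler_pM2l.
apply: le_trans zM _; apply: le_trans IH.
by rewrite ler_peMl ?cmod_ge0 // exprn_ege1 // ler1n.
Qed.

Lemma julia_bounded : exists2 M : R, 0 < M & forall z, julia_in_plane f z -> cmod z <= M.
Proof.
have [M M1 HM] := composition_growth.
have M0 : 0 < M by exact: lt_le_trans M1.
exists M => // z Jz; rewrite leNgt; apply/negP => zM; apply: Jz.
exists [set x : sphere | if x is Some y then M < cmod y else True]; split => //.
  rewrite openE => -[y My|_].
    rewrite /interior /=; apply/nbhs_cmod; exists (cmod y - M); first by rewrite subr_gt0.
    move=> w wy /=; have := cmodB y ((y : R[i]) - w).
    by rewrite subKr cmod_distC; lra.
  pose Q := [set y : C | 0 - M <= complex.Re y <= 0 + M /\ 0 - M <= complex.Im y <= 0 + M].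
  have cQ : compact Q by exact: compact_square.
  exists Q; first by split => //; apply: compact_closed cQ; exact: norm_hausdorff.
  move=> _ [[y nQy <-]|-> //] /=; rewrite ltNge; apply/negP => yM; apply: nQy.
  have := le_trans (Re_le_cmod y) yM; have := le_trans (Im_le_cmod y) yM.
  by rewrite !ler_norml /Q /= sub0r add0r.
(* The whole sequence tends to oo on this neighbourhood of oo: the chordal distance 2 / sqrt (1 +
   |w|^2) is at most 2 / 2^n, uniformly. *)
move=> phi hphi; exists id; split => //; exists (fun=> None) => K cK KU e e0.
have [N HN] : exists N, (2^-1 : R) ^+ N <= e / 4.
  by apply: small_power; [lra | rewrite divr_gt0].
exists N => // n /= Nn [y Ky|//].
rewrite -[chordal _ _]/(2 / Num.sqrt (1 + cmod (composition f (phi n).+1).[y] ^+ 2)).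
have yM : M < cmod y by exact: (KU _ Ky).
have := HM (phi n).+1 y (ltW yM); set w := (X in _ <= X) => wlb; rewrite -/w.
have p0 : 0 < (2 : R) ^+ n by rewrite exprn_gt0.
have wn : 2 ^+ n <= w.
  apply: le_trans wlb; apply: (@le_trans _ _ (2 ^+ (phi n).+1)).
    by rewrite ler_weXn2l ?ler1n // leqW // strictly_increasing_ge.
  by rewrite ler_peMr ?exprn_ge0 //; lra.
have w0 : 0 < w by exact: lt_le_trans wn.
have sw : w <= Num.sqrt (1 + w ^+ 2).
  by rewrite -{1}(ger0_norm (ltW w0)) -sqrtr_sqr ler_sqrt ?lerDr ?addr_ge0 ?sqr_ge0.
have s0 : 0 < Num.sqrt (1 + w ^+ 2) by exact: lt_le_trans sw.
rewrite ltr_pdivrMr //.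
have e4 : 4 <= e * 2 ^+ n.
  have HN' : 2 ^- n <= e / 4.
    by apply: le_trans HN; rewrite -exprVn ler_wiXn2l // ?invr_ge0 // invf_le1 ?ler1n.
  by move: HN'; rewrite ler_pdivlMr // ler_pdivrMl // mulrC.
have : e * 2 ^+ n <= e * Num.sqrt (1 + w ^+ 2).
  by rewrite ler_pM2l // (le_trans wn).
by lra.
Qed.

End Julia.

Theorem theorem4p1 (R : realType) (f : nat -> {poly R[i]})
    (f_regular : regular_polynomial_sequence f)
    (mu : probability (borelC R) R)
    (mu_eq : is_equilibrium_measure (julia_in_plane f) mu)
    (l : nat) (l_gt0 : (0 < l)%N) :
  let F := composition f l in
  let D := (\prod_(1 <= i < l.+1) deg (f i))%N in
  let a := fun j : nat => ((lead_coef F)^-1 *: F)`_j in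
  (lead_coef F)^-1 *: F = 'X^D + \sum_(j < D) a j *: 'X^j /\
  forall k : nat, (1 <= k <= D - 1)%N ->
    moment mu k = power_sum k F / D%:R /\
    power_sum k F + \sum_(1 <= j < k) a (D - j)%N * power_sum (k - j) F
      = - (k%:R * a (D - k)%N).
Proof.
move=> F D a.
have df := f_regular.1.
have sF : size F = D.+1 by exact: deg_composition.
split; first exact: normalized_expansion.
move=> k /andP[k0 kD1]; have kD : (0 < k < D)%N by lia.
split; last exact: normalized_newton.
have F1 : (1 < size F)%N by rewrite sF; lia.
have [M M0 HM] := julia_bounded f_regular.
(* [rho] is taken to be [M * 2], so that the Julia set lies in the disc of radius rho / 2. *)
have MM : 0 < M * 2 by rewrite mulr_gt0.
have := @moment_minimizer R F (M * 2) F1 MM (julia_in_plane f) mu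
  (measurable_julia f) mu_eq.
rewrite sF /=; apply => //.
  by move=> z /HM; rewrite mulfK.
by move=> z x Jz xz; apply: contra_not Jz => /(fatou_saturated F1 (esym xz)).
Qed.
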